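(* Let $(A,q)$ be a finite metric abelian group. Consider the following three kinds of data, with tower $\mathcal T_n$, coefficient function $f$, braid elements $r_i$ and Pauli realization $\Phi_n$ as given in the context: Family $\mathrm I^\epsilon$ for $\epsilon\in\{\pm1\}$ and $Q\in\mathcal Q^\epsilon(q)$; Family $\mathrm{II}_E$ for an admissible datum $(E,Q_E,P_E)$; and Family $\mathrm{III}$. In each case let $D,\alpha,\beta$ be given by the table $$\begin{array}{ccccc}\text{family}&D&f(0)&\alpha&\beta\\ \hline \mathrm I^\epsilon&|A|&|A|^{-1/2}&1&\sqrt{|A|}\\ \mathrm{II}_E&|A|&\overline{\gamma(P_E)}|A|^{-1}&\overline{\gamma(P_E)}&1\\ \mathrm{III}&|A|^2&|A|^{-1}&1&|A|\end{array}$$ Then the coefficient trace $D^n\varepsilon_n$ agrees with the ordinary matrix trace in the Pauli realization, i.e. $\mathrm{Tr}(\Phi_n(x))=D^n\varepsilon_n(x)$ for all $n\ge1$ and $x\in\mathcal T_n$, and the cyclic linear forms $\mathrm{tr}_n=D^n\varepsilon_n$ together with $\alpha,\beta$ form a scalar enhancement of the braid-compatible family $(r_i)$. (Ordinary Family II is the case $E=\mathrm{id}_A$.)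
   Context: $\mathrm U(1)$ = complex numbers of modulus one. A finite metric abelian group $(A,q)$: $A$ finite abelian (additive), $q:A\to\mathrm U(1)$ with $q(-a)=q(a)$ and $\langle a,b\rangle:=\frac{q(a+b)}{q(a)q(b)}$ a nondegenerate symmetric bicharacter. $\mathcal Q^{+1}(q)=\{q\chi\}$ and $\mathcal Q^{-1}(q)=\{q^{-1}\chi\}$, $\chi$ ranging over $\mathrm{Hom}(A,\mathrm U(1))$. $\gamma(F)=|A|^{-1/2}\sum_{a\in A}F(a)$. An admissible datum $(E,Q_E,P_E)$ consists of $E\in\mathrm{Aut}(A)$ with $\langle Ex,y\rangle=\langle x,Ey\rangle$ and $Q_E,P_E:A\to\mathrm U(1)$ with $Q_E(x+y)=Q_E(x)Q_E(y)\langle Ex,y\rangle$ and $P_E(x+y)=P_E(x)P_E(y)\langle E^{-1}x,y\rangle$. Towers. For a finite abelian group $G$, a normalized $\mathrm U(1)$-valued 2-cocycle $\nu$ and a $\mathrm U(1)$-valued bicharacter $\tau$ on $G$, $\mathcal T_n(G;\nu,\tau)$ ($n\ge1$) is the unital $*$-algebra generated by $U_i^g$ ($1\le i<n$, $g\in G$) with $U_i^0=1$, $U_i^gU_i^h=\nu(g,h)U_i^{g+h}$, $U_i^gU_j^h=U_j^hU_i^g$ for $|i-j|>1$, $U_i^gU_{i+1}^h=\tau(g,h)U_{i+1}^hU_i^g$, and $(U_i^g)^*=(U_i^g)^{-1}$; the normal-ordered monomials $U_1^{g_1}\cdots U_{n-1}^{g_{n-1}}$ form a basis, $\mathcal T_1=\mathbb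 C$, and $\mathcal T_n\subset\mathcal T_{n+1}$. $\varepsilon_n(x)$ is the coefficient of the identity monomial in $x$. For $f:G\to\mathbb C$ put $r_i=\sum_{g\in G}f(g)U_i^g$. Family data. $\mathrm I^\epsilon$: $G=A$, $\nu=1$, $\tau(a,b)=\langle a,b\rangle$, $f(a)=|A|^{-1/2}Q(a)$. $\mathrm{II}_E$: $G=A\oplus A$, $\nu=1$, $\tau((t,c),(t',c'))=\langle c,t'\rangle\langle c',t\rangle$, $f(t,c)=\overline{\gamma(P_E)}|A|^{-1}Q_E(t)P_E(c)$. $\mathrm{III}$: $G=A\oplus A$, $\nu((a,b),(c,d))=\langle a,c\rangle\langle b,c\rangle\langle b,d\rangle$, $\tau((a,b),(c,d))=\langle b,c\rangle\langle a,d\rangle^{-1}$, $f(a,b)=|A|^{-1}$. In each case the $r_i$ are unitary and satisfy the braid relations. Pauli realizations. $V=\mathbb C[A]$ with orthonormal basis $e_x$, $X_ae_x=e_{x+a}$, $Z_ae_x=\langle a,x\rangle e_x$, $W=V\otimes V$; a second subscript indicates the tensor factor. $\Phi_n$ is the $*$-representation of $\mathcal T_n$ given by: Family $\mathrm I^\epsilon$, on $V^{\otimes n}$, $U_i^a\mapsto X_{a,i}Z_{a,i+1}$; Family $\mathrm{II}_E$, on $V^{\otimes n}$, $U_i^{(t,c)}\mapsto X_{t,i}X_{-t,i+1}Z_{c,i}Z_{c,i+1}$; Family $\mathrm{III}$, on $W^{\otimes n}$, $U_i^{(a,b)}\mapsto q(a)^{-1}q(b)^{-1}\mathsf P_a\mathsf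 Q_{-b}$ acting on the $i$-th and $(i+1)$-st $W$-factors, where $\mathsf P_a=(I\otimes Z_a)\otimes(Z_a\otimes I)$ and $\mathsf Q_b=(X_b\otimes I)\otimes(X_b\otimes X_b)$ on $W\otimes W$. Scalar enhancement: cyclic linear forms $\mathrm{tr}_n:\mathcal T_n\to\mathbb C$ ($\mathrm{tr}_n(xy)=\mathrm{tr}_n(yx)$, $n\ge1$) and nonzero scalars $\alpha,\beta$ with $\mathrm{tr}_{n+1}(xr_n)=\alpha\beta\,\mathrm{tr}_n(x)$ and $\mathrm{tr}_{n+1}(xr_n^{-1})=\alpha^{-1}\beta\,\mathrm{tr}_n(x)$ for all $n\ge1$, $x\in\mathcal T_n\subset\mathcal T_{n+1}$. *)

(* Defs.v *)
From HB Require Import structures.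
From mathcomp Require Import all_boot all_order all_fingroup all_algebra all_field.
From mathcomp Require Import reals complex zify.

Set Implicit Arguments.
Unset Strict Implicit.
Unset Printing Implicit Defensive.

Import Order.TTheory GRing.Theory Num.Theory.
Local Open Scope ring_scope.

HB.instance Definition _ (A B : finZmodType) := Finite.on (A * B)%type.
HB.instance Definition _ (I : finType) (B : finZmodType) :=
  Finite.on {ffun I -> B}.

Section FiniteMetricGroups.
Variable C : numClosedFieldType.

Definition u1_valued (S : Type) (f : S -> C) : Prop := forall x, `|f x| = 1.

Record bicharacter (G : zmodType) (b : G -> G -> C) : Prop := {
  bichar_u1 : forall x y, `|b x y| = 1;
  bicharDl : forall x y z, b (x + y) z = b x z * b y z;
  bicharDr : forall x y z, b x (y + z) = b x y * b x z }.

Record character (G : zmodType) (chi : G -> C) : Prop := {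
  char_u1 : u1_valued chi;
  charD : forall x y, chi (x + y) = chi x * chi y }.

Record cocycle2 (G : zmodType) (nu : G -> G -> C) : Prop := {
  cocycle_u1 : forall x y, `|nu x y| = 1;
  cocycle0l : forall x, nu 0 x = 1;
  cocycle0r : forall x, nu x 0 = 1;
  cocycleA : forall x y z, nu x y * nu (x + y) z = nu y z * nu x (y + z) }.

Variable A : finZmodType.
Implicit Types (q Q P : A -> C) (a b : A).

Definition pairing q a b : C := q (a + b) / (q a * q b).

Record metric_group q : Prop := {
  metric_u1 : u1_valued q;
  metric_even : forall a, q (- a) = q a;
  metric_bichar : bicharacter (pairing q);
  metric_sym : forall a b, pairing q a b = pairing q b a;
  metric_nondeg : forall a, (forall b, pairing q a b = 1) -> a = 0 }.

Definition quadratic_class q (eps : int) Q : Prop :=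
  exists2 chi : A -> C, character chi & forall a, Q a = q a ^ eps * chi a.

Definition gamma Q : C := (sqrtC #|A|%:R)^-1 * \sum_(a : A) Q a.

Record admissible q (E : {perm A}) Q P : Prop := {
  admissible_add : {morph E : x y / x + y};
  admissible_sym : forall x y, pairing q (E x) y = pairing q x (E y);
  admissible_Qu1 : u1_valued Q;
  admissible_Pu1 : u1_valued P;
  admissible_Q : forall x y, Q (x + y) = Q x * Q y * pairing q (E x) y;
  admissible_P :
    forall x y, P (x + y) = P x * P y * pairing q ((E^-1)%g x) y }.

End FiniteMetricGroups.

Section Towers.
Variables (C : numClosedFieldType) (G : finZmodType) (nu tau : G -> G -> C).

Record star_operation (T : falgType C) (st : T -> T) : Prop := {
  starD : forall x y, st (x + y) = st x + st y;
  starZ : forall (c : C) x, st (c *: x) = c^* *: st x;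
  starM : forall x y, st (x * y) = st y * st x;
  starK : involutive st }.

Definition monomial (T : nat -> falgType C) (U : forall n, nat -> G -> T n)
    n (g : {ffun 'I_n.-1 -> G}) : T n :=
  \prod_(j < n.-1) U n j.+1 (g j).

(* A model of the tower.  Only the levels n >= 1 and the generators U n i g   *)
(* with 1 <= i < n are meaningful.  The defining relations, together with the *)
(* fact that the normal-ordered monomials form a basis (in particular they    *)
(* span, so the U n i g generate), determine the tower up to isomorphism.     *)
Record tower := Tower {
  tower_alg :> nat -> falgType C;
  gen : forall n, nat -> G -> tower_alg n;
  star : forall n, tower_alg n -> tower_alg n;
  incl : forall n, {lrmorphism tower_alg n -> tower_alg n.+1};
  tower_star : forall n, (0 < n)%N -> star_operation (@star n);
  gen0 : forall n i, (0 < i < n)%N -> gen n i 0 = 1;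
  genM : forall n i g h, (0 < i < n)%N ->
    gen n i g * gen n i h = nu g h *: gen n i (g + h);
  gen_far : forall n i j g h, (0 < i < n)%N -> (0 < j < n)%N ->
    (i.+1 < j)%N || (j.+1 < i)%N ->
    gen n i g * gen n j h = gen n j h * gen n i g;
  gen_near : forall n i g h, (0 < i)%N -> (i.+1 < n)%N ->
    gen n i g * gen n i.+1 h = tau g h *: (gen n i.+1 h * gen n i g);
  gen_star : forall n i g, (0 < i < n)%N ->
    gen n i g \is a GRing.unit /\ star (gen n i g) = (gen n i g)^-1;
  monomial_basis : forall n, (0 < n)%N ->
    basis_of fullv (codom_tuple (@monomial tower_alg gen n));
  incl_gen : forall n i g, (0 < i < n)%N -> incl n (gen n i g) = gen n.+1 i g;
  incl_star : forall n x, (0 < n)%N -> incl n (star x) = star (incl n x);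
  incl_inj : forall n, (0 < n)%N -> injective (incl n) }.

Variable T : tower.

Definition coef_id n (x : T n) : C :=
  coord (codom_tuple (@monomial T (@gen T) n))
    (enum_rank (0 : {ffun 'I_n.-1 -> G})) x.

Definition braid (f : G -> C) n i : T n := \sum_(g : G) f g *: gen T n i g.

Definition coef_trace (D : C) n (x : T n) : C := D ^+ n * coef_id x.

(* r n i is the element r_i of T n.  Invertibility is required because the   *)
(* ring inverse of a non-unit is a junk value.                                *)
Record scalar_enhancement (r : forall n, nat -> T n)
    (tr : forall n, T n -> C) (alpha beta : C) : Prop := {
  enh_linear : forall n, (0 < n)%N -> scalar (tr n);
  enh_cyclic : forall n, (0 < n)%N -> forall x y, tr n (x * y) = tr n (y * x);
  enh_alpha : alpha != 0;
  enh_beta : beta != 0;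
  enh_unit : forall n i, (0 < i < n)%N -> r n i \is a GRing.unit;
  enh_pos : forall n, (0 < n)%N -> forall x : T n,
    tr n.+1 (incl T n x * r n.+1 n) = alpha * beta * tr n x;
  enh_neg : forall n, (0 < n)%N -> forall x : T n,
    tr n.+1 (incl T n x * (r n.+1 n)^-1) = alpha^-1 * beta * tr n x }.

Record star_representation n d (P : nat -> G -> 'M[C]_d) (Phi : T n -> 'M[C]_d)
    : Prop := {
  repr_linear : linear Phi;
  repr1 : Phi 1 = 1%:M;
  reprM : forall x y, Phi (x * y) = Phi x *m Phi y;
  repr_star : forall x, Phi (star x) = map_mx Num.conj (Phi x)^T;
  repr_gen : forall i g, (0 < i < n)%N -> Phi (gen T n i g) = P i g }.

End Towers.

Section Operators.
Variable C : numClosedFieldType.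

(* Operators on C[S], as matrices in the basis (e_x), x in S. *)
Definition op (S : finType) := 'M[C]_#|S|.

(* k y x is the coefficient of e_y in the image of e_x *)
Definition op_of (S : finType) (k : S -> S -> C) : op S :=
  \matrix_(i, j) k (enum_val i) (enum_val j).

Definition entry (S : finType) (M : op S) (y x : S) : C :=
  M (enum_rank y) (enum_rank x).

(* C[S] (x) C[S'] has basis indexed by S * S' *)
Definition tens (S S' : finType) (M : op S) (N : op S') : op (S * S')%type :=
  op_of (fun y x : S * S' => entry M y.1 x.1 * entry N y.2 x.2).

(* C[S]^{(x) n} has basis indexed by {ffun 'I_n -> S} *)
Definition tensn (S : finType) n (M : 'I_n -> op S) : op {ffun 'I_n -> S} :=
  op_of (fun y x : {ffun 'I_n -> S} => \prod_(j < n) entry (M j) (y j) (x j)).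

(* M acting on the k-th tensor factor, 1 <= k <= n *)
Definition site (S : finType) n (k : nat) (M : op S) : op {ffun 'I_n -> S} :=
  tensn (fun j => if j.+1 == k then M else 1%:M).

Variables (A : finZmodType) (q : A -> C).

Definition opX (a : A) : op A := op_of (fun y x => (y == x + a)%:R).
Definition opZ (a : A) : op A := op_of (fun y x => pairing q a x *+ (y == x)).

Definition pauliI n i (a : A) : op {ffun 'I_n -> A} :=
  site n i (opX a) *m site n i.+1 (opZ a).

Definition pauliII n i (tc : A * A) : op {ffun 'I_n -> A} :=
  site n i (opX tc.1) *m site n i.+1 (opX (- tc.1))
    *m site n i (opZ tc.2) *m site n i.+1 (opZ tc.2).

(* The tensor factors are copies of W, with basis indexed by A * A. *)
Definition opP n i (a : A) : op {ffun 'I_n -> A * A} :=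
  site n i (tens 1%:M (opZ a)) *m site n i.+1 (tens (opZ a) 1%:M).

Definition opQ n i (b : A) : op {ffun 'I_n -> A * A} :=
  site n i (tens (opX b) 1%:M) *m site n i.+1 (tens (opX b) (opX b)).

Definition pauliIII n i (ab : A * A) : op {ffun 'I_n -> A * A} :=
  ((q ab.1)^-1 * (q ab.2)^-1) *: (opP n i ab.1 *m opQ n i (- ab.2)).

End Operators.

Section Families.
Variables (C : numClosedFieldType) (A : finZmodType) (q : A -> C).
Local Notation "<| a , b |>" := (pairing q a b) (format "<| a ,  b |>").

Definition nu_triv (G : finZmodType) (_ _ : G) : C := 1.

Definition fI (Q : A -> C) (a : A) : C := (sqrtC #|A|%:R)^-1 * Q a.

Definition tauII (g h : A * A) : C := <|g.2, h.1|> * <|h.2, g.1|>.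
Definition fII (Q P : A -> C) (g : A * A) : C :=
  (gamma P)^* * #|A|%:R^-1 * Q g.1 * P g.2.

Definition nuIII (g h : A * A) : C :=
  <|g.1, h.1|> * <|g.2, h.1|> * <|g.2, h.2|>.
Definition tauIII (g h : A * A) : C := <|g.2, h.1|> * <|g.1, h.2|>^-1.
Definition fIII (_ : A * A) : C := #|A|%:R^-1.

End Families.

(* P n i g is the value on gen n i g of the Pauli realization.  The second    *)
(* and third clauses say that a *-representation with these values exists     *)
(* (it is unique, the generators spanning T n multiplicatively), and that its *)
(* matrix trace is the coefficient trace.                                     *)
Definition enhanced_by_matrix_trace (C : numClosedFieldType) (G : finZmodType)
    (nu tau : G -> G -> C) (T : tower nu tau) (S : finType)
    (P : forall n, nat -> G -> op C {ffun 'I_n -> S})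
    (f : G -> C) (D f0 alpha beta : C) : Prop :=
  [/\ f 0 = f0,
      forall n, (0 < n)%N ->
        exists Phi : T n -> op C {ffun 'I_n -> S}, star_representation (P n) Phi,
      forall n, (0 < n)%N ->
        forall Phi : T n -> op C {ffun 'I_n -> S}, star_representation (P n) Phi ->
        forall x : T n, \tr (Phi x) = coef_trace D x
    & scalar_enhancement (@braid C G nu tau T f)
        (@coef_trace C G nu tau T D) alpha beta].

(* The relations are consistent: the twisted group algebra of G ^ (n - 1) is  *)
(* a tower, for every cocycle nu and bicharacter tau.                         *)
Section TwistedGroupAlgebra.
Variables (C : numClosedFieldType) (K : finZmodType) (w : K -> K -> C).

Definition twisted (_ : cocycle2 w) : Type := {ffun K -> C^o}.

Variable Hw : cocycle2 w.
Local Notation T := (twisted Hw).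

HB.instance Definition _ := Vector.copy T {ffun K -> C^o}.

Definition delta (g : K) : T := [ffun x => (x == g)%:R : C^o].

Definition tmul (x y : T) : T :=
  locked (\sum_g \sum_h (x g * y h * w g h : C) *: delta (g + h)).

Lemma scaleffE (c : C) (x : T) g : (c *: x : T) g = c * x g.
Proof. by rewrite ffunE. Qed.

Lemma addffE (x y : T) g : (x + y : T) g = x g + y g.
Proof. by rewrite ffunE. Qed.

Lemma twistedE (x : T) : x = \sum_g (x g : C) *: delta g.
Proof.
apply/ffunP => k; rewrite sum_ffunE (bigD1 k) //= big1 => [|i ne].
  by rewrite addr0 !ffunE eqxx /GRing.scale /= mulr1.
by rewrite !ffunE eq_sym (negbTE ne) /GRing.scale /= mulr0.
Qed.

Lemma tmulDl : left_distributive tmul +%R.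
Proof.
move=> x y z; rewrite /tmul -!lock -big_split; apply: eq_bigr => g _ /=.
rewrite -big_split; apply: eq_bigr => h _ /=.
by rewrite addffE !mulrDl scalerDl.
Qed.

Lemma tmulDr : right_distributive tmul +%R.
Proof.
move=> x y z; rewrite /tmul -!lock -big_split; apply: eq_bigr => g _ /=.
rewrite -big_split; apply: eq_bigr => h _ /=.
by rewrite addffE mulrDr mulrDl scalerDl.
Qed.

Lemma tmulZl (c : C) x y : tmul (c *: x) y = c *: tmul x y.
Proof.
rewrite /tmul -!lock scaler_sumr; apply: eq_bigr => g _ /=.
rewrite scaler_sumr; apply: eq_bigr => h _ /=.
by rewrite scaleffE scalerA !mulrA.
Qed.

Lemma tmulZr (c : C) x y : tmul x (c *: y) = c *: tmul x y.
Proof.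
rewrite /tmul -!lock scaler_sumr; apply: eq_bigr => g _ /=.
rewrite scaler_sumr; apply: eq_bigr => h _ /=.
by rewrite scaleffE scalerA [x g * _]mulrCA !mulrA.
Qed.

Lemma tmul0l x : tmul 0 x = 0.
Proof. by rewrite -[X in tmul X _](scale0r (0 : T)) tmulZl scale0r. Qed.

Lemma tmul0r x : tmul x 0 = 0.
Proof. by rewrite -[X in tmul _ X](scale0r (0 : T)) tmulZr scale0r. Qed.

Lemma tmul_suml (I : finType) (F : I -> T) y :
  tmul (\sum_i F i) y = \sum_i tmul (F i) y.
Proof.
by apply: (big_morph (fun x => tmul x y)) => [u v|]; rewrite ?tmulDl ?tmul0l.
Qed.

Lemma tmul_sumr (I : finType) (F : I -> T) x :
  tmul x (\sum_i F i) = \sum_i tmul x (F i).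
Proof.
by apply: (big_morph (tmul x)) => [u v|]; rewrite ?tmulDr ?tmul0r.
Qed.

Lemma delta_mul g h : tmul (delta g) (delta h) = w g h *: delta (g + h).
Proof.
rewrite /tmul -!lock (bigD1 g) //= [X in _ + X]big1 => [|i ne]; last first.
  by rewrite big1 // => j _; rewrite ffunE (negbTE ne) !mul0r scale0r.
rewrite addr0 (bigD1 h) //= [X in _ + X]big1 => [|i ne]; last first.
  by rewrite [X in _ * X * _]ffunE (negbTE ne) mulr0 mul0r scale0r.
by rewrite addr0 !ffunE !eqxx !mul1r.
Qed.

Lemma tmulA : associative tmul.
Proof.
move=> x y z.
rewrite (twistedE x) !tmul_suml; apply: eq_bigr => g _; rewrite !tmulZl.
congr (_ *: _).
rewrite (twistedE y) !tmul_suml !tmul_sumr tmul_suml.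
apply: eq_bigr => h _; rewrite !tmulZl !tmulZr !tmulZl; congr (_ *: _).
rewrite (twistedE z) !tmul_sumr; apply: eq_bigr => k _.
rewrite !tmulZr; congr (_ *: _).
by rewrite !delta_mul !tmulZl !tmulZr !delta_mul !scalerA cocycleA // addrA.
Qed.

Lemma tmul1l : left_id (delta 0) tmul.
Proof.
move=> x; rewrite (twistedE x) tmul_sumr; apply: eq_bigr => g _.
by rewrite tmulZr delta_mul cocycle0l // scale1r add0r.
Qed.

Lemma tmul1r : right_id (delta 0) tmul.
Proof.
move=> x; rewrite (twistedE x) tmul_suml; apply: eq_bigr => g _.
by rewrite tmulZl delta_mul cocycle0r // scale1r addr0.
Qed.

Lemma tone_neq0 : delta 0 != 0.
Proof.
apply/eqP => /ffunP/(_ 0); rewrite !ffunE eqxx => /eqP.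
by rewrite (oner_eq0 C).
Qed.

HB.instance Definition _ := GRing.Zmodule_isNzRing.Build T
  tmulA tmul1l tmul1r tmulDl tmulDr tone_neq0.
HB.instance Definition _ := GRing.Lmodule_isLalgebra.Build C T
  (fun c x y => esym (tmulZl c x y)).
HB.instance Definition _ := GRing.Lalgebra_isAlgebra.Build C T
  (fun c x y => esym (tmulZr c x y)).
HB.instance Definition _ := Algebra_isFalgebra.Build C T.

Lemma deltaM g h : delta g * delta h = w g h *: delta (g + h).
Proof. exact: delta_mul. Qed.

Lemma delta0 : delta 0 = 1. Proof. by []. Qed.

Lemma w_neq0 g h : w g h != 0.
Proof. by rewrite -normr_eq0 (cocycle_u1 Hw) oner_eq0. Qed.

Lemma w_conj g h : (w g h)^* = (w g h)^-1.
Proof. by rewrite invC_norm (cocycle_u1 Hw) expr1n invr1 mul1r. Qed.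

Lemma wN g : w g (- g) = w (- g) g.
Proof.
have := cocycleA Hw g (- g) g.
by rewrite subrr addNr (cocycle0l Hw) (cocycle0r Hw) !mulr1.
Qed.

Definition dinv g : T := (w g (- g))^-1 *: delta (- g).

Lemma dinvr g : delta g * dinv g = 1.
Proof.
rewrite /dinv -scalerAr deltaM scalerA mulVf ?w_neq0 // scale1r subrr.
exact: delta0.
Qed.

Lemma dinvl g : dinv g * delta g = 1.
Proof.
rewrite /dinv -scalerAl deltaM scalerA wN mulVf ?w_neq0 // scale1r addNr.
exact: delta0.
Qed.

Lemma delta_unit g : delta g \is a GRing.unit.
Proof. by apply/unitrP; exists (dinv g); rewrite dinvl dinvr. Qed.

Lemma delta_inv g : (delta g)^-1 = dinv g.
Proof. by rewrite -[LHS]mul1r -(dinvl g) mulrK ?delta_unit. Qed.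

Definition tstar (x : T) : T := \sum_g ((x g)^* : C) *: (delta g)^-1.

Lemma tstarD x y : tstar (x + y) = tstar x + tstar y.
Proof.
rewrite /tstar -big_split; apply: eq_bigr => g _ /=.
by rewrite addffE rmorphD scalerDl.
Qed.

Lemma tstarZ (c : C) x : tstar (c *: x) = c^* *: tstar x.
Proof.
rewrite /tstar scaler_sumr; apply: eq_bigr => g _ /=.
by rewrite scaleffE rmorphM scalerA.
Qed.

Lemma tstar_sum (I : finType) (F : I -> T) :
  tstar (\sum_i F i) = \sum_i tstar (F i).
Proof.
apply: (big_morph tstar) => [u v|]; first exact: tstarD.
by rewrite -(scale0r (0 : T)) tstarZ rmorph0 !scale0r.
Qed.

Lemma tstar_delta g : tstar (delta g) = (delta g)^-1.
Proof.
rewrite /tstar (bigD1 g) //= ffunE eqxx rmorph1 scale1r big1 ?addr0 // => i ne.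
by rewrite ffunE (negbTE ne) rmorph0 scale0r.
Qed.

Lemma tstar_op : star_operation tstar.
Proof.
split; [exact: tstarD | exact: tstarZ | |].
- move=> x y.
  rewrite (twistedE x) mulr_suml !tstar_sum mulr_sumr; apply: eq_bigr => g _.
  rewrite -scalerAl !tstarZ -scalerAr; congr (_ *: _).
  rewrite (twistedE y) mulr_sumr !tstar_sum mulr_suml; apply: eq_bigr => h _.
  rewrite -scalerAr !tstarZ -scalerAl; congr (_ *: _).
  rewrite deltaM tstarZ !tstar_delta -invrM ?delta_unit // deltaM.
  by rewrite w_conj invrZ ?unitfE ?w_neq0 ?delta_unit.
- move=> x; rewrite [in RHS](twistedE x) [tstar x]/tstar tstar_sum.
  apply: eq_bigr => g _.
  rewrite tstarZ conjCK; congr (_ *: _).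
  rewrite delta_inv tstarZ tstar_delta delta_inv /dinv opprK scalerA.
  by rewrite fmorphV /= w_conj invrK wN mulfV ?w_neq0 // scale1r.
Qed.

Lemma delta_basis (I : finType) (F : I -> T) (e : I -> K) : bijective e ->
  (forall i, F i = delta (e i)) -> basis_of fullv (codom_tuple F).
Proof.
move=> [e' eK e'K] FE.
rewrite /basis_of; apply/andP; split.
  apply/eqP/vspaceP => x; rewrite memvf (twistedE x).
  apply: memv_suml => g _; apply: memvZ; apply: memv_span.
  by apply/codomP; exists (e' g); rewrite FE e'K.
apply/freeP => k Hk i.
have tn (j : 'I_#|I|) : (codom_tuple F)`_j = F (enum_val j).
  rewrite -tnth_nth.
  have ->: tnth (codom_tuple F) j = F (tnth (enum_tuple I) j).
    by rewrite /codom_tuple tnth_map.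
  by rewrite (tnth_nth (enum_val j)) /enum_val; congr F; apply: set_nth_default;
     rewrite -cardE.
move/ffunP/(_ (e (enum_val i))): Hk.
rewrite sum_ffunE (bigD1 i) //= big1 => [|j ne].
  by rewrite addr0 tn FE !ffunE eqxx /GRing.scale /= mulr1.
rewrite tn FE !ffunE (inj_eq (can_inj eK)) (inj_eq enum_val_inj) eq_sym.
by rewrite (negbTE ne) /GRing.scale /= mulr0.
Qed.

End TwistedGroupAlgebra.

Section TowerExists.
Variables (C : numClosedFieldType) (G : finZmodType) (nu tau : G -> G -> C).
Hypotheses (Hnu : cocycle2 nu) (Htau : bicharacter tau).
Local Notation K m := {ffun 'I_m -> G}.

Let tau_neq0 g h : tau g h != 0.
Proof. by rewrite -normr_eq0 (bichar_u1 Htau) oner_eq0. Qed.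

Let tau0l g : tau 0 g = 1.
Proof.
have := bicharDl Htau 0 0 g; rewrite addr0 -[LHS]mulr1.
by move/(mulfI (tau_neq0 _ _)).
Qed.

Let tau0r g : tau g 0 = 1.
Proof.
have := bicharDr Htau g 0 0; rewrite addr0 -[LHS]mulr1.
by move/(mulfI (tau_neq0 _ _)).
Qed.

Definition tcocycle m (g h : K m) : C :=
  (\prod_j nu (g j) (h j)) *
  \prod_(i < m) \prod_(j < m) (if j == i.+1 :> nat then (tau (h i) (g j))^-1 else 1).

Lemma tcocycleP m : cocycle2 (@tcocycle m).
Proof.
split=> [x y|x|x|x y z]; rewrite /tcocycle.
- rewrite normrM !normr_prod big1 => [|j _]; last exact: cocycle_u1.
  rewrite mul1r big1 // => i _; rewrite normr_prod big1 // => j _.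
  by case: ifP; rewrite ?normr1 // normfV (bichar_u1 Htau) invr1.
- rewrite big1 => [|j _]; last by rewrite ffunE cocycle0l.
  rewrite mul1r big1 // => i _; rewrite big1 // => j _.
  by rewrite ffunE tau0r invr1 if_same.
- rewrite big1 => [|j _]; last by rewrite ffunE cocycle0r.
  rewrite mul1r big1 // => i _; rewrite big1 // => j _.
  by rewrite ffunE tau0l invr1 if_same.
- rewrite mulrACA [RHS]mulrACA; congr (_ * _).
    by rewrite -!big_split; apply: eq_bigr => j _ /=; rewrite !ffunE cocycleA.
  rewrite -!big_split; apply: eq_bigr => i _ /=.
  rewrite -!big_split; apply: eq_bigr => j _ /=.
  case: ifP => // _.
  rewrite !ffunE (bicharDl Htau) (bicharDr Htau) -!invfM.
  by congr _^-1; rewrite mulrA mulrC.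
Qed.

Definition talg n : falgType C := twisted (@tcocycleP n.-1).

Definition single m i (g : G) : K m := [ffun j : 'I_m => if j.+1 == i then g else 0].

Definition tgen n i g : talg n := delta (tcocycleP n.-1) (single n.-1 i g).

Lemma single0 m i : single m i 0 = 0.
Proof. by apply/ffunP => j; rewrite !ffunE if_same. Qed.

Lemma singleD m i g h : single m i (g + h) = single m i g + single m i h.
Proof. by apply/ffunP => j; rewrite !ffunE; case: ifP; rewrite ?addr0. Qed.

Lemma tcocycle_single m i j g h : (0 < i <= m)%N -> (0 < j <= m)%N ->
  tcocycle (single m i g) (single m j h) =
  (if i == j then nu g h else 1) * (if i == j.+1 then (tau h g)^-1 else 1).
Proof.
case: i => // i /= im; case: j => // j /= jm; rewrite /tcocycle !eqSS.
congr (_ * _).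
  rewrite (bigD1 (Ordinal im)) //= big1 ?mulr1 => [|k ne]; last first.
    rewrite [single _ _ g _]ffunE eqSS.
    by rewrite -[(k : nat) == i]/(k == Ordinal im) (negbTE ne) cocycle0l.
  by rewrite !ffunE !eqSS eqxx; case: ifP => // _; rewrite cocycle0r.
rewrite (bigD1 (Ordinal jm)) //= [X in _ * X]big1 => [|k ne]; last first.
  rewrite big1 // => l _; rewrite ffunE eqSS.
  by rewrite -[(k : nat) == j]/(k == Ordinal jm) (negbTE ne) tau0l invr1 if_same.
rewrite mulr1 (bigD1 (Ordinal im)) //= big1 ?mulr1 => [|k ne]; last first.
  rewrite [single _ _ g _]ffunE eqSS.
  by rewrite -[(k : nat) == i]/(k == Ordinal im) (negbTE ne) tau0r invr1 if_same.
by rewrite !ffunE !eqSS !eqxx.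
Qed.

Lemma tgenM n i j g h : (0 < i < n)%N -> (0 < j < n)%N ->
  tgen n i g * tgen n j h =
  ((if i == j then nu g h else 1) * (if i == j.+1 then (tau h g)^-1 else 1))
    *: delta (tcocycleP n.-1) (single n.-1 i g + single n.-1 j h).
Proof.
case: n => [|n]; first by rewrite andbF.
by move=> Hi Hj; rewrite /tgen deltaM tcocycle_single.
Qed.

Lemma trunc_mul m (g : K m) (gn : nat -> G) k : (forall j : 'I_m, gn j = g j) ->
  (k <= m)%N ->
  \prod_(j < k) delta (tcocycleP m) (single m j.+1 (gn j)) =
  delta (tcocycleP m) [ffun j : 'I_m => if (j < k)%N then g j else 0].
Proof.
move=> gnE; elim: k => [|k IH] km.
  rewrite big_ord0 -delta0; congr delta.
rewrite big_ord_recr /= IH ?(ltnW km) // deltaM.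
have ->: tcocycle [ffun j : 'I_m => if (j < k)%N then g j else 0]
  (single m k.+1 (gn k)) = 1.
  rewrite /tcocycle big1 => [|j _]; last first.
    rewrite !ffunE eqSS; case: ltngtP => _; rewrite ?cocycle0l ?cocycle0r //.
  rewrite mul1r big1 // => i _; rewrite big1 // => j _.
  case: eqP => // ji; rewrite !ffunE eqSS ji.
  case: (ltngtP i k) => ik; rewrite ?tau0l ?invr1 //.
  by rewrite ltnNge ik leqnSn /= tau0r invr1.
rewrite scale1r; congr delta; apply/ffunP => j; rewrite !ffunE eqSS ltnS.
by case: ltngtP => jk; rewrite ?addr0 ?add0r // -jk gnE.
Qed.

Lemma tmonomial n (g : K n.-1) : monomial tgen g = delta (tcocycleP n.-1) g.
Proof.
rewrite /monomial /tgen.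
pose gn j := oapp g 0 (insub j).
have gnE (j : 'I_n.-1) : gn j = g j by rewrite /gn valK.
transitivity (\prod_(j < n.-1) delta (tcocycleP n.-1) (single n.-1 j.+1 (gn j))).
  by apply: eq_bigr => j _; rewrite gnE.
rewrite (@trunc_mul _ g) //; congr delta.
by apply/ffunP => j; rewrite ffunE ltn_ord.
Qed.

Definition ext m (g : K m) : K m.+1 :=
  [ffun j => oapp g 0 (unlift ord_max j)].

Lemma ext_widen m (g : K m) (j : 'I_m) (le : (m <= m.+1)%N) :
  ext g (widen_ord le j) = g j.
Proof.
rewrite ffunE (_ : widen_ord le j = lift ord_max j) ?liftK //.
by apply: val_inj; rewrite /= /bump leqNgt ltn_ord.
Qed.

Lemma ext_max m (g : K m) : ext g ord_max = 0.
Proof. by rewrite ffunE unlift_none. Qed.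

Lemma extD m (g h : K m) : ext (g + h) = ext g + ext h.
Proof.
by apply/ffunP => j; rewrite !ffunE; case: unliftP => [k|] _ /=; rewrite ?ffunE ?addr0.
Qed.

Lemma ext_inj m : injective (@ext m).
Proof.
move=> g h eq; apply/ffunP => j.
by rewrite -(ext_widen g j (leqnSn m)) eq ext_widen.
Qed.

Lemma tcocycle_ext m (g h : K m) : tcocycle (ext g) (ext h) = tcocycle g h.
Proof.
rewrite /tcocycle; congr (_ * _).
  rewrite big_ord_recr /= !ext_max cocycle0l // mulr1.
  by apply: eq_bigr => j _; rewrite !ext_widen.
rewrite big_ord_recr /= [X in _ * X]big1 => [|j _]; last first.
  by rewrite ext_max tau0l invr1 if_same.
rewrite mulr1; apply: eq_bigr => i _.
rewrite big_ord_recr /= ext_max tau0r invr1 if_same mulr1.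
by apply: eq_bigr => j _; rewrite !ext_widen.
Qed.

Lemma ext_single m i g : (0 < i <= m)%N -> ext (single m i g) = single m.+1 i g.
Proof.
move=> Hi; apply/ffunP => j; rewrite [LHS]ffunE [RHS]ffunE.
case: unliftP => [k ->|->] /=.
  by rewrite ffunE /bump leqNgt ltn_ord.
by case: eqP => // mi; rewrite -mi ltnn in Hi.
Qed.

Section Incl.
Variable m : nat.
Local Notation T := (talg m.+1).
Local Notation T' := (talg m.+2).
Local Notation d := (delta (tcocycleP m)).
Local Notation d' := (delta (tcocycleP m.+1)).

Definition tincl (x : T) : T' := \sum_g (x g : C) *: d' (ext g).

Fact tincl_linear : linear tincl.
Proof.
move=> c x y; rewrite /tincl scaler_sumr -big_split; apply: eq_bigr => g _ /=.
by rewrite addffE scaleffE scalerDl scalerA.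
Qed.
HB.instance Definition _ := GRing.isLinear.Build C T T' _ tincl tincl_linear.

Lemma tincl_delta g : tincl (d g) = d' (ext g).
Proof.
rewrite /tincl (bigD1 g) //= ffunE eqxx scale1r big1 ?addr0 // => i ne.
by rewrite ffunE (negbTE ne) scale0r.
Qed.

Fact tincl_monoid : monoid_morphism tincl.
Proof.
split.
  rewrite -delta0 tincl_delta -delta0; congr delta.
  by apply/ffunP => j; rewrite !ffunE; case: unliftP => [k|] _ //=; rewrite ffunE.
move=> x y; rewrite [in LHS](twistedE x) [in RHS](twistedE x).
rewrite mulr_suml !linear_sum mulr_suml; apply: eq_bigr => g _ /=.
rewrite -scalerAl !linearZ -scalerAl; congr (_ *: _).
rewrite [in LHS](twistedE y) [in RHS](twistedE y).
rewrite mulr_sumr !linear_sum mulr_sumr; apply: eq_bigr => h _ /=.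
rewrite -scalerAr !linearZ -scalerAr; congr (_ *: _).
by rewrite /= deltaM linearZ /= !tincl_delta deltaM tcocycle_ext extD.
Qed.
HB.instance Definition _ := GRing.isMonoidMorphism.Build T T' tincl tincl_monoid.

Lemma tincl_inj : injective tincl.
Proof.
have E x g : tincl x (ext g) = x g.
  rewrite /tincl sum_ffunE (bigD1 g) //= big1 => [|i ne].
    by rewrite addr0 !ffunE eqxx /GRing.scale /= mulr1.
  rewrite !ffunE (inj_eq (@ext_inj m)) eq_sym (negbTE ne).
  by rewrite /GRing.scale /= mulr0.
by move=> x y eq; apply/ffunP => g; rewrite -!E eq.
Qed.

Lemma tincl_star x : tincl (tstar x) = tstar (tincl x).
Proof.
rewrite /tincl tstar_sum -/(tincl _) [tstar x]/tstar linear_sum.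
apply: eq_bigr => g _.
by rewrite linearZ tstarZ tstar_delta rmorphV ?delta_unit //= tincl_delta.
Qed.

End Incl.

Definition tower_incl n : {lrmorphism talg n -> talg n.+1} :=
  if n is m.+1 then (@tincl m : {lrmorphism _ -> _})
  else (idfun : {lrmorphism talg 0 -> talg 1}).

Lemma tower_exists : inhabited (tower nu tau).
Proof.
split; exists talg tgen (fun n => @tstar _ _ _ (tcocycleP n.-1)) tower_incl.
- by move=> n _; apply: tstar_op.
- by move=> n i _; rewrite /tgen single0 delta0.
- move=> n i g h Hi; rewrite tgenM // eqxx ltn_eqF // mulr1.
  by rewrite /tgen singleD.
- move=> n i j g h Hi Hj ij; rewrite !tgenM // addrC.
  suff [-> -> -> ->] : [/\ i == j = false, j == i = false, i == j.+1 = false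
    & j == i.+1 = false] by [].
  by move: ij; clear; split; apply/eqP; lia.
- move=> n i g h i0 iN; rewrite !tgenM ?i0 ?iN ?(ltnW iN) // addrC scalerA.
  have [-> -> ->] : [/\ i == i.+1 = false, i.+1 == i = false & i == i.+2 = false].
    by split; apply/eqP; lia.
  by rewrite eqxx !mul1r mulfV.
- by move=> n i g _; rewrite /= tstar_delta; split=> //; apply: delta_unit.
- move=> n n0; apply: (@delta_basis _ _ _ (tcocycleP n.-1) _ _ id).
    by exists id.
  exact: tmonomial.
- case=> [|n] i g Hi; first by rewrite andbF in Hi.
  by rewrite /tower_incl /tgen /= tincl_delta ext_single.
- by case=> // n x _; apply: tincl_star.
- by case=> // n _; apply: tincl_inj.
Qed.

End TowerExists.

Section FamilyTowersExist.
Variables (C : numClosedFieldType) (A : finZmodType) (q : A -> C).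
Hypothesis Hq : metric_group q.

Lemma cocycle2_triv (G : finZmodType) : cocycle2 (@nu_triv C G).
Proof. by split=> *; rewrite /nu_triv ?normr1. Qed.

Lemma cocycle2_bichar (G : finZmodType) (b : G -> G -> C) :
  bicharacter b -> cocycle2 b.
Proof.
move=> Hb; have b0 x y : b x y != 0.
  by rewrite -normr_eq0 (bichar_u1 Hb) oner_eq0.
split=> [x y|x|x|x y z]; first exact: bichar_u1.
- by apply: (mulfI (b0 0 x)); rewrite -(bicharDl Hb) addr0 mulr1.
- by apply: (mulfI (b0 x 0)); rewrite -(bicharDr Hb) addr0 mulr1.
- by rewrite (bicharDl Hb) (bicharDr Hb) mulrA mulrC.
Qed.

Let Hb := metric_bichar Hq.

Lemma bichar_tauII : bicharacter (tauII q).
Proof.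
split=> [x y|x y z|x y z]; rewrite /tauII.
- by rewrite normrM !(bichar_u1 Hb) mulr1.
- by rewrite (bicharDl Hb) (bicharDr Hb) mulrACA.
- by rewrite (bicharDl Hb) (bicharDr Hb) mulrACA.
Qed.

Lemma bichar_nuIII : bicharacter (nuIII q).
Proof.
split=> [x y|x y z|x y z]; rewrite /nuIII.
- by rewrite normrM [X in X * _]normrM !(bichar_u1 Hb) !mulr1.
- by rewrite !(bicharDl Hb) (mulrACA (pairing q x.1 z.1)) [LHS]mulrACA.
- by rewrite !(bicharDr Hb) (mulrACA (pairing q x.1 y.1)) [LHS]mulrACA.
Qed.

Lemma bichar_tauIII : bicharacter (tauIII q).
Proof.
split=> [x y|x y z|x y z]; rewrite /tauIII.
- by rewrite normrM normfV !(bichar_u1 Hb) invr1 mulr1.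
- by rewrite !(bicharDl Hb) invfM mulrACA.
- by rewrite !(bicharDr Hb) invfM mulrACA.
Qed.

Lemma family_towers_exist :
  [/\ inhabited (tower (@nu_triv C A) (pairing q)),
      inhabited (tower (@nu_triv C (A * A)%type) (tauII q))
    & inhabited (tower (nuIII q) (tauIII q))].
Proof.
split; apply: tower_exists.
- exact: cocycle2_triv.
- exact: Hb.
- exact: cocycle2_triv.
- exact: bichar_tauII.
- exact: cocycle2_bichar bichar_nuIII.
- exact: bichar_tauIII.
Qed.

End FamilyTowersExist.

(* Main.v *)
Require Import Defs.
From HB Require Import structures.
From mathcomp Require Import all_boot all_order all_fingroup all_algebra all_field.
From mathcomp Require Import reals complex zify ring.
Set Implicit Arguments.
Unset Strict Implicit.
Unset Printing Implicit Defensive.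
Import Order.TTheory GRing.Theory Num.Theory.
Local Open Scope ring_scope.

(* On C[S^n], for S = A or A * A with its nondegenerate pairing, every        *)
(* generator acts as a phase times a Weyl operator supported on two           *)
(* neighbouring sites.  Left multiplication by a generator permutes the       *)
(* normal-ordered monomials up to scalars that depend only on nu and tau, so  *)
(* any matrices satisfying the defining relations extend multiplicatively.    *)
(* Reading the sites from left to right, a monomial with g <> 0 acts as a     *)
(* nontrivial Weyl operator, whose trace vanishes: the matrix trace is        *)
(* therefore D ^ n times the coefficient of the identity, which gives         *)
(* cyclicity.  Multiplying by r_n or r_n^-1 adjoins a last letter, so the     *)
(* Markov property only involves the identity coefficients of r_n and r_n^-1; *)
(* the latter is the conjugate of the former because r_n is unitary, by the   *)
(* Gauss sum computation.                                                     *)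

(** All three families are instances of [enhanced_by_pauli], a statement about phases times Weyl
    operators on neighbouring copies of C[S]. The defining relations alone fix how a generator acts
    from the left on the monomial basis ([normal_order]). Hence the linear map sending basis
    monomials to the matching matrix products is a *-representation ([mx_repP]). Its trace vanishes
    on every monomial except the identity ([trace_mx_mon]), so it equals the coefficient trace
    ([trace_repr]) and cyclicity is inherited from matrices.

    For the Markov property, right multiplication by r_n adjoins a last letter and only f(0)
    survives ([coef_incl_braid]). The identity coefficient of the inverse of r_n is the conjugate of
    f(0) by [braid_inv]. Its correlation hypothesis is a Gauss sum identity
    ([quadratic_correlation]) in Families I and II, and nondegeneracy of [nuIII] in Family III. What
    remains is arithmetic with the table; in Family II it uses |gamma(P_E)| = 1 ([norm_gamma]). *)

Section Bicharacters.
Variables (C : numClosedFieldType) (G : finZmodType).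
Implicit Types (b : G -> G -> C) (chi F : G -> C).

(** * Character sums and correlations of quadratic functions *)

Lemma conjC_u1 (x : C) : `|x| = 1 -> x^* = x^-1.
Proof. by move=> x1; rewrite invC_norm x1 expr1n invr1 mul1r. Qed.

Lemma u1_neq0 (x : C) : `|x| = 1 -> x != 0.
Proof. by move=> x1; rewrite -normr_eq0 x1 oner_eq0. Qed.

(** Translating the summation variable by [k] multiplies the sum by [chi k]. *)
Lemma char_sum0 chi k : character chi -> chi k != 1 -> \sum_g chi g = 0.
Proof.
move=> Hchi k1; have: chi k * \sum_g chi g = \sum_g chi g.
  rewrite mulr_sumr [RHS](reindex_inj (addrI k)) /=.
  by apply: eq_bigr => g _; rewrite charD.
move/eqP; rewrite -subr_eq0 -{2}[\sum_g _]mul1r -mulrBl mulf_eq0 subr_eq0.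
by rewrite (negbTE k1) => /eqP.
Qed.

Definition bichar_nondeg b := forall x, (forall y, b x y = 1) -> x = 0.

Section Basics.
Variable b : G -> G -> C.
Hypothesis Hb : bicharacter b.

Lemma bichar_neq0 x y : b x y != 0.
Proof. exact/u1_neq0/bichar_u1. Qed.

Lemma bichar0l x : b 0 x = 1.
Proof.
by apply: (mulfI (bichar_neq0 0 x)); rewrite -(bicharDl Hb) addr0 mulr1.
Qed.

Lemma bichar0r x : b x 0 = 1.
Proof.
by apply: (mulfI (bichar_neq0 x 0)); rewrite -(bicharDr Hb) addr0 mulr1.
Qed.

Lemma bicharNl x y : b (- x) y = (b x y)^-1.
Proof.
apply: (mulIf (bichar_neq0 x y)).
by rewrite -(bicharDl Hb) addNr bichar0l mulVf ?bichar_neq0.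
Qed.

Lemma bicharNr x y : b x (- y) = (b x y)^-1.
Proof.
apply: (mulIf (bichar_neq0 x y)).
by rewrite -(bicharDr Hb) addNr bichar0r mulVf ?bichar_neq0.
Qed.

Lemma bichar_sum x : bichar_nondeg b ->
  \sum_y b x y = #|G|%:R *+ (x == 0).
Proof.
move=> ndg; case: eqP => [->|x0].
  by rewrite (eq_bigr (fun=> 1)) ?sumr_const // => y _; rewrite bichar0l.
have [y y1] : exists y, b x y != 1.
  apply/existsP; apply: contra_notT x0 => /existsPn y1.
  by apply: ndg => y; apply/eqP; move: (y1 y); rewrite negbK.
apply: (char_sum0 _ y1); split=> [z|z t]; first exact: bichar_u1.
exact: bicharDr.
Qed.

(* The Gauss sum computation: the correlation of F with its translate by k is *)
(* the sum of the character b k, up to the factor F k.                        *)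
Lemma quadratic_correlation F k : bichar_nondeg b -> u1_valued F ->
  (forall x y, F (x + y) = F x * F y * b x y) ->
  \sum_h F (k + h) * (F h)^* = #|G|%:R *+ (k == 0).
Proof.
move=> ndg F1 FD.
transitivity (F k * \sum_h b k h).
  rewrite mulr_sumr; apply: eq_bigr => h _.
  by rewrite FD conjC_u1 // mulrAC mulfK ?u1_neq0 // mulrC.
rewrite bichar_sum //; case: eqP => [->|_]; last by rewrite mulr0.
suff -> : F 0 = 1 by rewrite mul1r.
apply: (mulfI (u1_neq0 (F1 0))).
by have := FD 0 0; rewrite addr0 bichar0l !mulr1.
Qed.

End Basics.
End Bicharacters.

(** * Weyl operators of a finite group with a bicharacter *)

Section Weyl.
Variables (C : numClosedFieldType) (K : finZmodType) (b : K -> K -> C).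
Hypothesis Hb : bicharacter b.

(* The Weyl operator X_x Z_z, with Z_z diagonal with eigenvalues b z. *)
Definition weyl (x z : K) : op C K := op_of (fun y k => b z k *+ (y == k + x)).

Lemma weyl0 : weyl 0 0 = 1%:M.
Proof.
apply/matrixP => i j; rewrite !mxE bichar0l // addr0.
by rewrite (inj_eq enum_val_inj).
Qed.

Lemma sum_enum_val (F : K -> C) : \sum_(j < #|K|) F (enum_val j) = \sum_k F k.
Proof.
rewrite [RHS](reindex (@enum_val K K)) //=.
exact: onW_bij (enum_val_bij K).
Qed.

Lemma weylM x z x' z' :
  weyl x z *m weyl x' z' = b z x' *: weyl (x + x') (z + z').
Proof.
apply/matrixP => i j; rewrite !mxE.
under eq_bigr do rewrite !mxE.
rewrite (sum_enum_val (fun k => b z k *+ (enum_val i == k + x) *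
  (b z' (enum_val j) *+ (k == enum_val j + x')))).
rewrite (bigD1 (enum_val j + x')) //= eqxx big1 ?addr0 => [|k ne]; last first.
  by rewrite (negbTE ne) mulr0n mulr0.
rewrite -addrA [x' + x]addrC; case: eqP => _; last by rewrite mul0r mulr0.
by rewrite (bicharDl Hb) (bicharDr Hb) mulrA mulrAC mulrC mulrA.
Qed.

Lemma weyl_adj x z :
  map_mx Num.conj (weyl x z)^T = b z x *: weyl (- x) (- z).
Proof.
apply/matrixP => i j; rewrite !mxE rmorphMn /=.
rewrite [in RHS]eq_sym subr_eq.
case: eqP => [->|_]; last by rewrite mulr0.
rewrite conjC_u1 ?(bichar_u1 Hb) // bicharNl // (bicharDr Hb) invfM.
by rewrite mulrCA divff ?mulr1 ?bichar_neq0.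
Qed.

(** A nonzero shift [x] leaves no diagonal entries; for [x = 0] the trace is the sum of the
    character [b z]. *)
Lemma trace_weyl x z : bichar_nondeg b ->
  \tr (weyl x z) = #|K|%:R *+ ((x == 0) && (z == 0)).
Proof.
move=> ndg; rewrite /mxtrace; under eq_bigr do rewrite mxE.
rewrite (sum_enum_val (fun k => b z k *+ (k == k + x))).
rewrite (eq_bigr (fun k => b z k *+ (x == 0))) => [|k _]; last first.
  by rewrite eq_sym -subr_eq0 [k + x]addrC addrK.
by rewrite sumrMnl bichar_sum // -mulrnA mulnb andbC.
Qed.

End Weyl.

(** * Tensor products of Weyl operators are Weyl operators of product groups *)

Section ProductBicharacters.
Variable C : numClosedFieldType.

Definition bichar_prod (S S' : finZmodType) (b : S -> S -> C)
    (b' : S' -> S' -> C) (x y : S * S') : C := b x.1 y.1 * b' x.2 y.2.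

Definition bichar_pow (S : finZmodType) (b : S -> S -> C) n
    (x y : {ffun 'I_n -> S}) : C := \prod_(j < n) b (x j) (y j).

Section Prod.
Variables (S S' : finZmodType) (b : S -> S -> C) (b' : S' -> S' -> C).
Hypotheses (Hb : bicharacter b) (Hb' : bicharacter b').

Lemma bichar_prodP : bicharacter (bichar_prod b b').
Proof.
split=> [x y|x y z|x y z]; rewrite /bichar_prod.
- by rewrite normrM (bichar_u1 Hb) (bichar_u1 Hb') mulr1.
- by rewrite (bicharDl Hb) (bicharDl Hb') mulrACA.
- by rewrite (bicharDr Hb) (bicharDr Hb') mulrACA.
Qed.

Lemma bichar_nondeg_prod : bichar_nondeg b -> bichar_nondeg b' ->
  bichar_nondeg (bichar_prod b b').
Proof.
move=> ndg ndg' [x x'] bx1; congr pair; [apply: ndg | apply: ndg'] => y.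
  by have := bx1 (y, 0); rewrite /bichar_prod (bichar0r Hb') mulr1.
by have := bx1 (0, y); rewrite /bichar_prod (bichar0r Hb) mul1r.
Qed.

Lemma tens_weyl x z x' z' : tens (weyl b x z) (weyl b' x' z') =
  weyl (bichar_prod b b') (x, x') (z, z').
Proof.
apply/matrixP => i j; rewrite !mxE /entry !mxE !enum_rankK.
rewrite mulrnAl mulrnAr -mulrnA mulnb andbC.
by rewrite [enum_val i]surjective_pairing [enum_val j]surjective_pairing.
Qed.

End Prod.

Section Pow.
Variables (S : finZmodType) (b : S -> S -> C).
Hypothesis Hb : bicharacter b.

Lemma bichar_powP n : bicharacter (@bichar_pow S b n).
Proof.
split=> [x y|x y z|x y z]; rewrite /bichar_pow.
- by rewrite normr_prod big1 // => j _; apply: bichar_u1.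
- by rewrite -big_split; apply: eq_bigr => j _; rewrite ffunE (bicharDl Hb).
- by rewrite -big_split; apply: eq_bigr => j _; rewrite ffunE (bicharDr Hb).
Qed.

Lemma bichar_pow_single n (x : {ffun 'I_n -> S}) (i : 'I_n) s :
  bichar_pow b x (single n i.+1 s) = b (x i) s.
Proof.
rewrite /bichar_pow (bigD1 i) //= ffunE eqxx big1 ?mulr1 // => j ne.
by rewrite ffunE eqSS (negbTE ne : (j == i :> nat) = false) bichar0r.
Qed.

Lemma bichar_pow_single2 n i j s t : (0 < i <= n)%N -> (0 < j <= n)%N ->
  bichar_pow b (single n i s) (single n j t) = if i == j then b s t else 1.
Proof.
case: j => // j _ /= lt_jn.
rewrite (bichar_pow_single _ (Ordinal lt_jn)) ffunE /= eq_sym.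
by case: eqP => // _; rewrite bichar0l.
Qed.

Lemma bichar_nondeg_pow n : bichar_nondeg b -> bichar_nondeg (@bichar_pow S b n).
Proof.
move=> ndg x bx1; apply/ffunP => i; rewrite ffunE; apply: ndg => s.
by rewrite -bichar_pow_single.
Qed.

Lemma tensn_weyl n (x z : {ffun 'I_n -> S}) :
  tensn (fun j => weyl b (x j) (z j)) = weyl (@bichar_pow S b n) x z.
Proof.
apply/matrixP => i j; rewrite !mxE /bichar_pow.
rewrite (eq_bigr (fun k => b (z k) (enum_val j k) *
   ((enum_val i k == enum_val j k + x k)%:R))) => [|k _]; last first.
  by rewrite /entry mxE !enum_rankK mulr_natr.
rewrite big_split /= -mulr_natr; congr (_ * _).
case: (eqVneq (enum_val i) _) => [->|ne].
  by rewrite big1 // => k _; rewrite ffunE eqxx.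
have [k /negbTE nek] : exists k, enum_val i k != enum_val j k + x k.
  apply/existsP; apply: contraR ne => /existsPn eqk.
  apply/eqP/ffunP => k; rewrite ffunE; apply/eqP.
  by move: (eqk k); rewrite negbK.
by rewrite (bigD1 k) //= nek mul0r.
Qed.

Lemma site_weyl n k s t : site n k (weyl b s t) =
  weyl (@bichar_pow S b n) (single n k s) (single n k t).
Proof.
rewrite -tensn_weyl /site /tensn; apply/matrixP => i j; rewrite !mxE.
by apply: eq_bigr => l _; rewrite !ffunE; case: ifP => //; rewrite weyl0.
Qed.

End Pow.
End ProductBicharacters.

(** * Left multiplication of a normal-ordered monomial by a generator *)

Section NormalOrdering.
Variables (C : numClosedFieldType) (G : finZmodType) (nu tau : G -> G -> C).

Definition pad m (h : {ffun 'I_m -> G}) (j : nat) : G := oapp h 0 (insub j).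

Lemma padE m (h : {ffun 'I_m -> G}) (j : 'I_m) : pad h j = h j.
Proof. by rewrite /pad valK. Qed.

(** The cost of inserting the letter numbered [i.+1]: it commutes with all earlier letters but its
    left neighbour, passing which costs an inverse [tau]; it then merges with the letter in its own
    slot at the cost of [nu]. *)
Definition swap_coef i (g : G) (h : nat -> G) : C :=
  (if i is i'.+1 then (tau (h i') g)^-1 else 1) * nu g (h i).

(* Scalars are given by a central map s, so that the relations make sense     *)
(* both in a tower and in a matrix ring of possibly zero dimension.           *)
Variables (R : pzRingType) (s : C -> R) (m : nat) (u : nat -> G -> R).
Hypotheses (s1 : s 1 = 1) (sM : forall c d, s (c * d) = s c * s d)
  (sC : forall c x, s c * x = x * s c) (tau_neq0 : forall g h, tau g h != 0).
Hypothesis uM : forall i g h, (0 < i <= m)%N ->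
  u i g * u i h = s (nu g h) * u i (g + h).
Hypothesis u_far : forall i j g h, (0 < i <= m)%N -> (0 < j <= m)%N ->
  (i.+1 < j)%N || (j.+1 < i)%N -> u i g * u j h = u j h * u i g.
Hypothesis u_near : forall i g h, (0 < i)%N -> (i < m)%N ->
  u i g * u i.+1 h = s (tau g h) * (u i.+1 h * u i g).

Lemma commute_initial i k g (h : nat -> G) : (k < i < m)%N ->
  u i.+1 g * \prod_(j < k) u j.+1 (h j) = \prod_(j < k) u j.+1 (h j) * u i.+1 g.
Proof.
elim: k => [|k IH] /andP[ki im]; first by rewrite big_ord0 mulr1 mul1r.
rewrite big_ord_recr /= mulrA IH ?(ltnW ki) // -!mulrA; congr (_ * _).
by apply: u_far; lia.
Qed.

(** Initial segments of the monomial allow induction on the length: either the last letter is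
    untouched, or it is the slot of the inserted letter, which must first cross its left
    neighbour. *)
Lemma normal_order_initial i k g (h : nat -> G) : (i <= k)%N -> (k < m)%N ->
  u i.+1 g * \prod_(j < k.+1) u j.+1 (h j) = s (swap_coef i g h) *
    \prod_(j < k.+1) u j.+1 ((if j == i :> nat then g else 0) + h j).
Proof.
move=> ik; elim: k ik => [|k IH] ik km.
  move: ik; rewrite leqn0 => /eqP->.
  by rewrite !big_ord1 /= uM ?km // /swap_coef mul1r.
rewrite big_ord_recr [in RHS]big_ord_recr /=.
move: ik; rewrite leq_eqVlt => /orP[/eqP->|ik]; last first.
  by rewrite mulrA IH ?(ltnW km) // -!mulrA gtn_eqF // add0r.
rewrite eqxx big_ord_recr [in RHS]big_ord_recr /= ltn_eqF // add0r.
have rE : \prod_(j < k) u j.+1 ((if j == k.+1 :> nat then g else 0) + h j) =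
    \prod_(j < k) u j.+1 (h j).
  by apply: eq_bigr => j _; rewrite ltn_eqF ?add0r // ltnS ltnW.
rewrite rE.
rewrite !mulrA commute_initial ?leqnn //.
have near : u k.+2 g * u k.+1 (h k) = s (tau (h k) g)^-1 *
    (u k.+1 (h k) * u k.+2 g).
  by rewrite u_near // mulrA -sM mulVf // s1 mul1r.
have sCA x c y : x * (s c * y) = s c * (x * y) by rewrite mulrA -sC mulrA.
set p := \prod_(j < k) _; set v := u k.+1 _.
rewrite -(mulrA p) near -!mulrA uM ?km // (sCA v) (sCA p) (sCA p).
by rewrite /swap_coef sM -!mulrA.
Qed.

Lemma normal_order i g (h : {ffun 'I_m -> G}) : (i < m)%N ->
  u i.+1 g * \prod_(j < m) u j.+1 (h j) = s (swap_coef i g (pad h)) *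
    \prod_(j < m) u j.+1 ((single m i.+1 g + h) j).
Proof.
move=> im; have [k mk] : exists k, m = k.+1 by exists m.-1; case: m im.
have pE (F : nat -> G) : \prod_(j < m) u j.+1 (F j) = \prod_(j < k.+1) u j.+1 (F j).
  by rewrite mk.
transitivity (u i.+1 g * \prod_(j < m) u j.+1 (pad h j)).
  by congr (_ * _); apply: eq_bigr => j _; rewrite padE.
have [ik km] : (i <= k)%N /\ (k < m)%N by rewrite -ltnS -mk.
rewrite pE normal_order_initial //.
rewrite -(pE (fun j => (if j == i then g else 0) + pad h j)); congr (_ * _).
by apply: eq_bigr => j _; rewrite padE !ffunE eqSS.
Qed.

End NormalOrdering.

(** * Monomial coefficients, representations and inverses in a tower *)

Section TowerTheory.
Variables (C : numClosedFieldType) (G : finZmodType) (nu tau : G -> G -> C).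
Variable T : tower nu tau.
Hypotheses (Hnu : bicharacter nu) (Htau : bicharacter tau).

Definition mon n (g : {ffun 'I_n.-1 -> G}) : T n := monomial (@gen _ _ _ _ T) g.

Definition coef n (g : {ffun 'I_n.-1 -> G}) (x : T n) : C :=
  coord (codom_tuple (@mon n)) (enum_rank g) x.

Lemma coef_idE n (x : T n) : coef_id x = coef 0 x. Proof. by []. Qed.

Lemma coef_linear n g : scalar (@coef n g).
Proof. by move=> c x y; rewrite /coef linearP. Qed.
HB.instance Definition _ n g :=
  GRing.isLinear.Build C (T n) C _ (@coef n g) (@coef_linear n g).

Lemma nth_codom_mon n (j : 'I_#|{ffun 'I_n.-1 -> G}|) :
  (codom_tuple (@mon n))`_j = mon (enum_val j).
Proof.
rewrite -tnth_nth /codom_tuple tnth_map (tnth_nth (enum_val j)) /enum_val.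
by congr mon; apply: set_nth_default; rewrite -cardE.
Qed.

Lemma coef_mon n g h : (0 < n)%N -> coef g (mon h : T n) = (h == g)%:R.
Proof.
move=> n0; rewrite /coef -[h in mon h](enum_rankK h) -nth_codom_mon.
rewrite coord_free ?(inj_eq enum_rank_inj) //.
exact: basis_free (monomial_basis T n0).
Qed.

Lemma tower_expand n (x : T n) : (0 < n)%N -> x = \sum_g coef g x *: mon g.
Proof.
move=> n0; rewrite [LHS](coord_basis (monomial_basis T n0)) ?memvf //.
rewrite [RHS](reindex (@enum_val {ffun 'I_n.-1 -> G} predT)) /=; last first.
  exact/onW_bij/enum_val_bij.
by apply: eq_bigr => j _; rewrite -[LHS]/(_ *: _) nth_codom_mon /coef enum_valK.
Qed.

Lemma tower_span n (P : T n -> Prop) : (0 < n)%N ->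
  (forall x y, P x -> P y -> P (x + y)) -> (forall (c : C) x, P x -> P (c *: x)) ->
  (forall g, P (mon g)) -> forall x, P x.
Proof.
move=> n0 PD PZ Pmon x; rewrite (tower_expand x n0).
apply: big_ind => // [|g _]; last exact: PZ.
by rewrite -(scale0r (mon 0)); apply: PZ.
Qed.

Lemma tower_ind n (P : T n -> Prop) : (0 < n)%N ->
  (forall x y, P x -> P y -> P (x + y)) -> (forall (c : C) x, P x -> P (c *: x)) ->
  P 1 -> (forall i g x, (0 < i < n)%N -> P x -> P (gen T n i g * x)) ->
  forall x, P x.
Proof.
move=> n0 PD PZ P1 PM; apply: tower_span => // g; rewrite /mon /monomial.
apply: (big_rec P) => // j x _ Px; apply: PM => //.
by rewrite -ltn_predRL ltn_ord.
Qed.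

Lemma mon0 n : (0 < n)%N -> mon 0 = 1 :> T n.
Proof.
move=> n0; rewrite /mon /monomial big1 // => j _.
by rewrite ffunE Defs.gen0 // -ltn_predRL ltn_ord.
Qed.

Lemma gen_mon n i g h : (i.+1 < n)%N -> gen T n i.+1 g * mon h =
  swap_coef nu tau i g (pad h) *: mon (single n.-1 i.+1 g + h).
Proof.
move=> lt_in; rewrite -mulr_algl.
apply: (@normal_order _ _ _ _ _ (fun c => c%:A) n.-1 (gen T n)) => //.
- by rewrite scale1r.
- by move=> c d; rewrite mulr_algl scalerA.
- by move=> c x; rewrite mulr_algl mulr_algr.
- exact: bichar_neq0.
- by move=> j a b jn; rewrite mulr_algl genM //; lia.
- by move=> j k a b jn kn jk; apply: gen_far => //; lia.
- by move=> j a b j0 jn; rewrite mulr_algl gen_near //; lia.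
- by lia.
Qed.

Lemma star1 n : (0 < n)%N -> star 1 = 1 :> T n.
Proof.
move=> /(tower_star T) st; rewrite -[LHS]mul1r -{1}(starK st 1).
by rewrite -(starM st) mul1r (starK st).
Qed.

Section Representation.
Variables (n d : nat) (P : nat -> G -> 'M[C]_d).
Hypothesis n0 : (0 < n)%N.
Hypothesis P0 : forall i, (0 < i < n)%N -> P i 0 = 1%:M.
Hypothesis PM : forall i g h, (0 < i < n)%N ->
  P i g *m P i h = nu g h *: P i (g + h).
Hypothesis P_far : forall i j g h, (0 < i < n)%N -> (0 < j < n)%N ->
  (i.+1 < j)%N || (j.+1 < i)%N -> P i g *m P j h = P j h *m P i g.
Hypothesis P_near : forall i g h, (0 < i)%N -> (i.+1 < n)%N ->
  P i g *m P i.+1 h = tau g h *: (P i.+1 h *m P i g).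
Hypothesis P_unitary : forall i g, (0 < i < n)%N ->
  map_mx Num.conj (P i g)^T *m P i g = 1%:M.

Definition mx_mon (g : {ffun 'I_n.-1 -> G}) : 'M[C]_d :=
  \prod_(j < n.-1) P j.+1 (g j).

(** Defined linearly on the monomial basis, so that only multiplicativity needs the relations. *)
Definition mx_rep (x : T n) : 'M[C]_d := \sum_g coef g x *: mx_mon g.

Lemma mx_rep_linear : linear mx_rep.
Proof.
move=> c x y; rewrite /mx_rep scaler_sumr -big_split; apply: eq_bigr => g _ /=.
by rewrite linearP scalerDl scalerA.
Qed.
HB.instance Definition _ :=
  GRing.isLinear.Build C (T n) 'M[C]_d _ mx_rep mx_rep_linear.

Lemma mx_rep_mon g : mx_rep (mon g) = mx_mon g.
Proof.
rewrite /mx_rep (bigD1 g) //= coef_mon // eqxx scale1r big1 ?addr0 // => h ne.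
by rewrite coef_mon // eq_sym (negbTE ne) scale0r.
Qed.

Lemma mx_rep1 : mx_rep 1 = 1%:M.
Proof.
rewrite -mon0 // mx_rep_mon /mx_mon big1 // => j _.
by rewrite ffunE P0 // -ltn_predRL ltn_ord.
Qed.

(** The scalar is the one of [gen_mon]; this agreement makes [mx_rep] multiplicative. *)
Lemma mx_gen_mon i g h : (i.+1 < n)%N -> P i.+1 g *m mx_mon h =
  swap_coef nu tau i g (pad h) *: mx_mon (single n.-1 i.+1 g + h).
Proof.
move=> lt_in; rewrite -mul_scalar_mx !mulmxE.
apply: (@normal_order _ _ _ _ _ (@scalar_mx C d) n.-1 P) => //.
- exact: scalar_mxM.
- by move=> c x; rewrite -mulmxE scalar_mxC.
- exact: bichar_neq0.
- by move=> j a b jn; rewrite -mulmxE mul_scalar_mx PM //; lia.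
- by move=> j k a b jn kn jk; apply: P_far => //; lia.
- by move=> j a b j0 jn; rewrite -!mulmxE mul_scalar_mx P_near //; lia.
- by lia.
Qed.

Lemma mx_rep_genM i g x : (0 < i < n)%N ->
  mx_rep (gen T n i g * x) = P i g *m mx_rep x.
Proof.
case: i => // i /= lt_in; move: x; apply: tower_span => // [x y Hx Hy|c x Hx|h].
- by rewrite mulrDr !linearD /= Hx Hy.
- by rewrite -scalerAr !linearZ /= Hx.
- by rewrite gen_mon // linearZ /= !mx_rep_mon mx_gen_mon.
Qed.

Lemma mx_rep_gen i g : (0 < i < n)%N -> mx_rep (gen T n i g) = P i g.
Proof.
by move=> lt_in; rewrite -[gen _ _ _ _]mulr1 mx_rep_genM // mx_rep1 mulmx1.
Qed.

Lemma mx_repM x y : mx_rep (x * y) = mx_rep x *m mx_rep y.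
Proof.
move: x; apply: tower_ind => // [x x' Hx Hx'|c x Hx||i g x lt_in Hx].
- by rewrite mulrDl !linearD /= mulmxDl Hx Hx'.
- by rewrite -scalerAl !linearZ /= -scalemxAl Hx.
- by rewrite mul1r mx_rep1 mul1mx.
- by rewrite -mulrA !mx_rep_genM // Hx mulmxA.
Qed.

Lemma mx_rep_star x : mx_rep (star x) = map_mx Num.conj (mx_rep x)^T.
Proof.
have st := tower_star T n0.
move: x; apply: tower_ind => // [x y Hx Hy|c x Hx||i g x lt_in Hx].
- by rewrite (starD st) !linearD /= map_mxD Hx Hy.
- by rewrite (starZ st) !linearZ /= map_mxZ Hx.
- by rewrite star1 // mx_rep1 trmx1 map_mx1.
- have [Ug starU] := gen_star T g lt_in.
  rewrite (starM st) !mx_repM trmx_mul map_mxM -Hx starU; congr (_ *m _).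
  (* The image of the inverse generator is the adjoint of [P i g]: insert U U^-1 = 1 on the right
     and cancel by unitarity. *)
  rewrite mx_rep_gen // -[RHS]mulmx1 -mx_rep1 -(mulrV Ug) mx_repM mx_rep_gen //.
  by rewrite mulmxA P_unitary // mul1mx.
Qed.

Lemma mx_repP : star_representation P mx_rep.
Proof.
split; [exact: mx_rep_linear|exact: mx_rep1|exact: mx_repM|exact: mx_rep_star|].
exact: mx_rep_gen.
Qed.

End Representation.

Lemma repr_mon n d (P : nat -> G -> 'M[C]_d) (Phi : T n -> 'M[C]_d) g :
  star_representation P Phi -> Phi (mon g) = mx_mon P g.
Proof.
move=> HPhi; rewrite /mon /monomial /mx_mon.
apply: (big_ind2 (fun x M => Phi x = M)) => [|x M y N <- <-|j _].
- exact: repr1 HPhi.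
- exact: reprM HPhi x y.
- by rewrite (repr_gen HPhi) // -ltn_predRL ltn_ord.
Qed.

Lemma trace_repr n d (P : nat -> G -> 'M[C]_d) (Phi : T n -> 'M[C]_d) (D : C) :
  (0 < n)%N -> star_representation P Phi ->
  (forall g : {ffun 'I_n.-1 -> G}, \tr (mx_mon P g) = D ^+ n *+ (g == 0)) ->
  forall x, \tr (Phi x) = coef_trace D x.
Proof.
move=> n0 HPhi trP; have lPhi := repr_linear HPhi.
have Phi0 : Phi 0 = 0.
  by have := lPhi (-1) 0 0; rewrite scaler0 addr0 scaleN1r addNr.
have PhiZ c x : Phi (c *: x) = c *: Phi x.
  by rewrite -[c *: x]addr0 lPhi Phi0 addr0.
apply: tower_span => // [x y Hx Hy|c x Hx|g].
- rewrite -[x]scale1r lPhi scale1r linearD /= Hx Hy /coef_trace !coef_idE.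
  by rewrite scale1r linearD /= mulrDr.
- by rewrite PhiZ linearZ /= Hx /coef_trace !coef_idE linearZ /= mulrCA.
- by rewrite (repr_mon _ HPhi) trP /coef_trace coef_idE coef_mon // mulr_natr.
Qed.

(** A monomial of level n times a generator with index n is a monomial of level n+1 ([app] appends
    the letter), and it is the identity only if both parts are trivial. *)
Lemma coef_incl_braid (F : G -> C) n (x : T n) : (0 < n)%N ->
  coef_id (incl T n x * braid T F n.+1 n) = F 0 * coef_id x.
Proof.
case: n x => // m x _; rewrite !coef_idE.
pose app (g : {ffun 'I_m -> G}) h : {ffun 'I_m.+1 -> G} :=
  [ffun j => oapp g h (unlift ord_max j)].
have app0 g h : (app g h == 0) = (g == 0) && (h == 0).
  apply/eqP/andP => [/ffunP gh0|[/eqP-> /eqP->]]; last first.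
    by apply/ffunP => j; rewrite !ffunE; case: unliftP => //= k _; rewrite ffunE.
  split; last by have := gh0 ord_max; rewrite !ffunE unlift_none => /eqP.
  apply/eqP/ffunP => j.
  by have := gh0 (lift ord_max j); rewrite !ffunE liftK.
have incl_mon g h : incl T m.+1 (mon g) * gen T m.+2 m.+1 h =
      mon (app g h : {ffun 'I_m.+2.-1 -> G}).
  rewrite /mon /monomial big_ord_recr /= rmorph_prod ffunE unlift_none.
  congr (_ * _); apply: eq_bigr => j _.
  rewrite [LHS](incl_gen T) ?ltnS ?ltn_ord // ffunE.
  have -> : widen_ord (leqnSn m) j = lift ord_max j.
    by apply: val_inj; rewrite /= /bump leqNgt ltn_ord.
  by rewrite liftK.
move: x; apply: tower_span => // [x y Hx Hy|c x Hx|g].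
- by rewrite linearD /= mulrDl !linearD /= Hx Hy mulrDr.
- by rewrite linearZ /= -scalerAl !linearZ /= Hx mulrCA.
rewrite /braid mulr_sumr linear_sum (bigD1 0) //= big1 ?addr0 => [|h h0].
  by rewrite -scalerAr linearZ /= incl_mon !coef_mon // app0 eqxx andbT.
rewrite -scalerAr linearZ /= incl_mon coef_mon // app0 (negbTE h0) andbF.
by rewrite mulr0.
Qed.

(** Right multiplication by [x] is injective, hence surjective by finite dimension, which yields a
    left inverse. *)
Lemma falg_mulr1_unit (aT : falgType C) (x y : aT) : x * y = 1 ->
  x \is a GRing.unit /\ x^-1 = y.
Proof.
move=> xy1; suff Ux : x \is a GRing.unit.
  by split=> //; apply: (mulrI Ux); rewrite divrr.
have kerx : lker (amulr x) == 0%VS.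
  apply/lker0P => u v /(congr1 ( *%R^~ y)).
  by rewrite !lfunE /= -!mulrA xy1 !mulr1.
have /memv_imgP[z _] : 1 \in limg (amulr x).
  suff /eqP-> : limg (amulr x) == fullv by rewrite memvf.
  by rewrite -dimv_leqif_eq ?subvf ?limg_dim_eq // (eqP kerx) capv0.
rewrite lfunE /= => zx1; apply/unitrP.
by exists y; split=> //; rewrite -[y]mul1r zx1 -(mulrA z) xy1 mulr1.
Qed.

(** The proposed inverse is the formal adjoint of the braid element, and the correlation hypothesis
    is its unitarity: the sum for [k] is the coefficient of the generator at [k] in the product. *)
Lemma braid_inv (f : G -> C) n i : (0 < i < n)%N ->
  (forall k, \sum_h f (k + h) * (f h)^* * nu k (- h) = (k == 0)%:R) ->
  braid T f n i \is a GRing.unit /\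
  (braid T f n i)^-1 = braid T (fun h => (f (- h))^* / nu (- h) h) n i.
Proof.
move=> lt_in f_corr; apply: falg_mulr1_unit; rewrite /braid mulr_suml.
transitivity (\sum_k (k == 0)%:R *: gen T n i k); last first.
  rewrite (bigD1 0) //= eqxx scale1r Defs.gen0 // big1 ?addr0 // => k k0.
  by rewrite (negbTE k0) scale0r.
under eq_bigr => g _.
  rewrite mulr_sumr (reindex_inj (addrI (- g))) /=.
  under eq_bigr => k _ do
    rewrite -scalerAl -scalerAr Defs.genM // !scalerA addNKr.
  over.
rewrite exchange_big; apply: eq_bigr => k _ /=.
rewrite -scaler_suml -f_corr (reindex_inj (addrI k)) /=; congr (_ *: _).
apply: eq_bigr => h _.
have -> : - (k + h) + k = - h by rewrite opprD addrC addNKr.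
rewrite opprK -!mulrA; congr (_ * (_ * _)).
(* Bimultiplicativity: nu(k + h, -h) / nu(h, -h) = nu(k, -h). *)
by rewrite (bicharDl Hnu) mulrCA mulVf ?mulr1 ?bichar_neq0.
Qed.

End TowerTheory.

(** * The common theorem for two-site Pauli generators *)

Section PauliFamily.
Variables (C : numClosedFieldType) (S G : finZmodType) (b : S -> S -> C).
(** [x0], [z0] are the shift and phase labels at the left site of a generator, [x1], [z1] those at
    the right site. [kappaM] encodes the product of two generators on the same pair of sites, [tauE]
    the exchange of adjacent generators at their shared site. *)
Variables (nu tau : G -> G -> C) (x0 x1 z0 z1 : G -> S) (kappa : G -> C).
Hypotheses (Hb : bicharacter b) (b_ndg : bichar_nondeg b).
Hypotheses (Hnu : bicharacter nu) (Htau : bicharacter tau).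
Hypotheses (x0D : {morph x0 : g h / g + h}) (x1D : {morph x1 : g h / g + h}).
Hypotheses (z0D : {morph z0 : g h / g + h}) (z1D : {morph z1 : g h / g + h}).
Hypothesis xz0_inj : forall g, x0 g = 0 -> z0 g = 0 -> g = 0.
Hypothesis kappa_u1 : u1_valued kappa.
Hypothesis kappaM : forall g h,
  kappa g * kappa h * (b (z0 g) (x0 h) * b (z1 g) (x1 h)) = nu g h * kappa (g + h).
Hypothesis tauE : forall g h, b (z1 g) (x0 h) = tau g h * b (z0 h) (x1 g).

Definition two_site n i (s t : S) : {ffun 'I_n -> S} :=
  single n i s + single n i.+1 t.

Definition pauli n i g : op C {ffun 'I_n -> S} :=
  kappa g *: weyl (@bichar_pow C S b n) (two_site n i (x0 g) (x1 g))
                                        (two_site n i (z0 g) (z1 g)).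

Lemma two_siteD n i s t s' t' :
  two_site n i (s + s') (t + t') = two_site n i s t + two_site n i s' t'.
Proof. by rewrite /two_site !singleD addrACA. Qed.

Lemma two_site0 n i : two_site n i 0 0 = 0.
Proof. by rewrite /two_site !single0 addr0. Qed.

Lemma bichar_two_site n i j s t s' t' : (0 < i < n)%N -> (0 < j < n)%N ->
  bichar_pow b (two_site n i s t) (two_site n j s' t') =
  (if i == j then b s s' * b t t' else 1) *
  ((if i == j.+1 then b s t' else 1) * (if i.+1 == j then b t s' else 1)).
Proof.
move=> lt_in lt_jn; have Hp := bichar_powP Hb n.
rewrite /two_site !(bicharDl Hp) !(bicharDr Hp) !bichar_pow_single2 //; try lia.
rewrite eqSS [X in _ * X = _]mulrC mulrACA.
by case: ifP => _ //; rewrite !mul1r.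
Qed.

Let morph0 (x : G -> S) : {morph x : g h / g + h} -> x 0 = 0.
Proof. by move=> xD; apply: (addrI (x 0)); rewrite -xD !addr0. Qed.

Lemma kappa0 : kappa 0 = 1.
Proof.
have := kappaM 0 0; rewrite !morph0 // !bichar0l // addr0 !mulr1 mul1r.
by rewrite -{3}[kappa 0]mul1r => /(mulIf (u1_neq0 (kappa_u1 0))).
Qed.

Lemma pauli0 n i : pauli n i 0 = 1%:M.
Proof.
rewrite /pauli kappa0 scale1r !morph0 // !two_site0 weyl0 //.
exact: bichar_powP.
Qed.

Lemma pauliM n i j g h : (0 < i < n)%N -> (0 < j < n)%N ->
  pauli n i g *m pauli n j h = (kappa g * kappa h *
   ((if i == j then b (z0 g) (x0 h) * b (z1 g) (x1 h) else 1) *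
   ((if i == j.+1 then b (z0 g) (x1 h) else 1) *
    (if i.+1 == j then b (z1 g) (x0 h) else 1)))) *:
  weyl (@bichar_pow C S b n)
    (two_site n i (x0 g) (x1 g) + two_site n j (x0 h) (x1 h))
    (two_site n i (z0 g) (z1 g) + two_site n j (z0 h) (z1 h)).
Proof.
move=> lt_in lt_jn; rewrite /pauli -scalemxAl -scalemxAr.
by rewrite (weylM (bichar_powP Hb n)) !scalerA bichar_two_site // !mulrA.
Qed.

Lemma pauli_mul n i g h : (0 < i < n)%N ->
  pauli n i g *m pauli n i h = nu g h *: pauli n i (g + h).
Proof.
move=> lt_in; rewrite pauliM // eqxx ltn_eqF // gtn_eqF // !mulr1 kappaM.
by rewrite /pauli scalerA -!two_siteD x0D x1D z0D z1D.
Qed.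

Lemma pauli_far n i j g h : (0 < i < n)%N -> (0 < j < n)%N ->
  (i.+1 < j)%N || (j.+1 < i)%N -> pauli n i g *m pauli n j h =
                                  pauli n j h *m pauli n i g.
Proof.
move=> lt_in lt_jn far; rewrite !pauliM //.
have [-> -> -> ->] : [/\ i == j = false, i == j.+1 = false,
    i.+1 == j = false & j == i = false] by split; apply/eqP; lia.
have [-> ->] : j == i.+1 = false /\ j.+1 == i = false by split; apply/eqP; lia.
by rewrite [kappa h * _]mulrC ![two_site n j _ _ + _]addrC.
Qed.

Lemma pauli_near n i g h : (0 < i)%N -> (i.+1 < n)%N ->
  pauli n i g *m pauli n i.+1 h = tau g h *: (pauli n i.+1 h *m pauli n i g).
Proof.
move=> i0 lt_in; have lt_in' := ltnW lt_in.
rewrite !pauliM ?i0 //= scalerA eqxx.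
have [-> -> -> ->] : [/\ i == i.+1 = false, i == i.+2 = false,
    i.+1 == i = false & i.+2 == i = false] by split; apply/eqP; lia.
rewrite ![two_site n i.+1 _ _ + _]addrC [kappa h * _]mulrC tauE.
by rewrite !mul1r mulr1 mulrCA.
Qed.

Lemma pauli_unitary n i g : map_mx Num.conj (pauli n i g)^T *m pauli n i g = 1%:M.
Proof.
have Hp := bichar_powP Hb n.
rewrite /pauli [(_ *: _)^T]linearZ /= map_mxZ (weyl_adj Hp) -!scalemxAl -scalemxAr (weylM Hp).
rewrite !addNr (weyl0 Hp) !scalerA /= bicharNl // conjC_u1 //.
by rewrite mulrAC mulfK ?bichar_neq0 // mulVf ?u1_neq0 // scale1r.
Qed.

Lemma mx_mon_pauli n (g : {ffun 'I_n.-1 -> G}) : exists c : C,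
  mx_mon (pauli n) g = c *: weyl (@bichar_pow C S b n)
    (\sum_(j < n.-1) two_site n j.+1 (x0 (g j)) (x1 (g j)))
    (\sum_(j < n.-1) two_site n j.+1 (z0 (g j)) (z1 (g j))).
Proof.
have Hp := bichar_powP Hb n; rewrite /mx_mon.
pose W x z := weyl (@bichar_pow C S b n) x z.
apply: (big_ind3 (fun M x z => exists c : C, M = c *: W x z)).
- by exists 1; rewrite scale1r /W weyl0.
- move=> M x z M' x' z' [c ->] [c' ->]; exists (c * c' * bichar_pow b z x').
  by rewrite -mulmxE -scalemxAl -scalemxAr /W (weylM Hp) !scalerA.
- by move=> j _; exists (kappa (g j)).
Qed.

(** Coordinate [j] of the sum receives only the left label of letter [j] and the right label of
    letter [j - 1], and the latter is trivial. *)
Lemma two_site_sum_eq0 n (x y : G -> S) (g : {ffun 'I_n.-1 -> G})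
    (j : 'I_n.-1) : y 0 = 0 -> (forall k : 'I_n.-1, (k < j)%N -> g k = 0) ->
  \sum_(k < n.-1) two_site n k.+1 (x (g k)) (y (g k)) = 0 -> x (g j) = 0.
Proof.
move=> y0 g_lt_j; have lt_jn : (j < n)%N by rewrite (leq_trans (ltn_ord j)) ?leq_pred.
move/ffunP/(_ (Ordinal lt_jn)); rewrite sum_ffunE ffunE (bigD1 j) //= big1.
  by rewrite !ffunE eqxx /= eqSS ltn_eqF // !addr0.
move=> k kj; rewrite !ffunE /= !eqSS eq_sym (negbTE kj : (k == j :> nat) = false).
by rewrite add0r; case: eqP => // jk; rewrite g_lt_j ?y0 // jk.
Qed.

Lemma trace_mx_mon n (g : {ffun 'I_n.-1 -> G}) : (0 < n)%N ->
  \tr (mx_mon (pauli n) g) = #|S|%:R ^+ n *+ (g == 0).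
Proof.
move=> n0; have Hp := bichar_powP Hb n.
case: (eqVneq g 0) => [->|/eqP g0].
  rewrite /mx_mon big1 => [|j _]; last by rewrite ffunE pauli0.
  by rewrite mxtrace1 card_ffun card_ord natrX.
have [c ->] := mx_mon_pauli g; rewrite linearZ /= trace_weyl //; last first.
  exact: bichar_nondeg_pow.
case: eqP => [sx0|_]; last by rewrite mulr0n mulr0.
case: eqP => [sz0|_]; last by rewrite mulr0n mulr0.
(* If both Weyl labels vanish, the letters are killed one by one from the left, since the left
   labels determine a letter. *)
case: g0; suff g_eq0 m (j : 'I_n.-1) : (j < m)%N -> g j = 0.
  by apply/ffunP => j; rewrite ffunE (g_eq0 j.+1).
elim: m j => // m IH j; rewrite ltnS leq_eqVlt => /orP[/eqP jm|]; last exact: IH.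
have g_lt_j (k : 'I_n.-1) : (k < j)%N -> g k = 0 by rewrite jm; apply: IH.
by apply: xz0_inj; [apply: two_site_sum_eq0 sx0 | apply: two_site_sum_eq0 sz0];
  rewrite ?morph0.
Qed.

Variables (f : G -> C) (D alpha beta : C) (T : tower nu tau).
Variable P : forall n, nat -> G -> op C {ffun 'I_n -> S}.
Arguments P : clear implicits.
Hypothesis PE : forall n i g, (0 < i < n)%N -> P n i g = pauli n i g.
Hypothesis DE : D = #|S|%:R.
Hypothesis f_corr : forall k,
  \sum_h f (k + h) * (f h)^* * nu k (- h) = (k == 0)%:R.
Hypotheses (alpha_u1 : `|alpha| = 1) (beta_neq0 : beta != 0).
Hypotheses (Df : D * f 0 = alpha * beta) (Dfc : D * (f 0)^* = alpha^-1 * beta).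

Lemma enhanced_by_pauli : enhanced_by_matrix_trace T P f D (f 0) alpha beta.
Proof.
have tr_eq n (Phi : T n -> op C {ffun 'I_n -> S}) : (0 < n)%N ->
    star_representation (P n) Phi -> forall x, \tr (Phi x) = coef_trace D x.
  move=> n0 HPhi; apply: trace_repr HPhi _ => // g.
  rewrite DE -trace_mx_mon //; congr (\tr _); apply: eq_bigr => j _.
  by rewrite PE // -ltn_predRL ltn_ord.
have ex_rep n : (0 < n)%N ->
    exists Phi : T n -> op C {ffun 'I_n -> S}, star_representation (P n) Phi.
  move=> n0; exists (mx_rep (P n)); apply: mx_repP => //.
  - by move=> i lt_in; rewrite PE // pauli0.
  - by move=> i g h lt_in; rewrite !PE // pauli_mul.
  - by move=> i j g h lt_in lt_jn far; rewrite !PE // pauli_far.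
  - by move=> i g h i0 lt_in; rewrite !PE ?i0 ?(ltnW lt_in) // pauli_near.
  - by move=> i g lt_in; rewrite PE // pauli_unitary.
split=> //; first by move=> n n0 Phi HPhi; apply: tr_eq.
have binv n i lt_in := @braid_inv _ _ _ _ T Hnu f n i lt_in f_corr.
split=> //.
- by move=> n n0 c x y; rewrite /coef_trace !coef_idE linearD linearZ /= mulrDr mulrCA.
(* Cyclicity is transported from the matrix trace through any representation. *)
- move=> n n0 x y; have [Phi HPhi] := ex_rep n n0.
  by rewrite -!(tr_eq _ _ n0 HPhi) !(reprM HPhi) mxtrace_mulC.
- exact: u1_neq0.
- by move=> n i lt_in; have [] := binv n i lt_in.
- move=> n n0 x; rewrite /coef_trace coef_incl_braid // -Df exprS.
  exact: mulrACA.
- move=> n n0 x; have [|_ ->] := binv n.+1 n; first by rewrite n0 ltnSn.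
  rewrite /coef_trace coef_incl_braid // -Dfc oppr0 bichar0l // divr1 exprS.
  exact: mulrACA.
Qed.

End PauliFamily.

(** * The three families *)

Section Families.
Variables (C : numClosedFieldType) (A : finZmodType).
Implicit Types (F : A -> C).

Lemma card_neq0 (G : finZmodType) : #|G|%:R != 0 :> C.
Proof. by rewrite pnatr_eq0 -lt0n; apply/card_gt0P; exists 0. Qed.

Lemma bichar_triv (G : finZmodType) : bicharacter (@nu_triv C G).
Proof. by split=> *; rewrite /nu_triv ?normr1 ?mulr1. Qed.

Lemma bichar_inv (G : finZmodType) (b : G -> G -> C) : bicharacter b ->
  bicharacter (fun x y => (b x y)^-1).
Proof.
move=> Hb; split=> [x y|x y z|x y z]; first by rewrite normfV (bichar_u1 Hb) invr1.
  by rewrite (bicharDl Hb) invfM.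
by rewrite (bicharDr Hb) invfM.
Qed.

Lemma bichar_twist (G : finZmodType) (b : G -> G -> C) (E : G -> G) :
  bicharacter b -> {morph E : x y / x + y} -> bicharacter (fun x y => b (E x) y).
Proof.
move=> Hb ED; split=> [x y|x y z|x y z]; first exact: bichar_u1.
  by rewrite ED (bicharDl Hb).
exact: bicharDr.
Qed.

Lemma bichar_nondeg_twist (G : finZmodType) (b : G -> G -> C) (E : G -> G) :
  bichar_nondeg b -> {morph E : x y / x + y} -> injective E ->
  bichar_nondeg (fun x y => b (E x) y).
Proof.
move=> ndg ED E_inj x bx1; apply: E_inj; rewrite (ndg _ bx1).
by apply: (addrI (E 0)); rewrite -ED !addr0.
Qed.

Lemma quadratic0 (G : finZmodType) (F : G -> C) (b : G -> G -> C) :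
  bicharacter b -> u1_valued F -> (forall x y, F (x + y) = F x * F y * b x y) ->
  F 0 = 1.
Proof.
move=> Hb F1 FD; apply: (mulfI (u1_neq0 (F1 0))).
by have := FD 0 0; rewrite addr0 bichar0l // !mulr1.
Qed.

Lemma sqrtC_nat_conj n : (sqrtC n%:R : C)^* = sqrtC n%:R.
Proof. by rewrite geC0_conj // sqrtC_ge0 ler0n. Qed.

(** The squared modulus of the Gauss sum is the sum over [k] of the correlations of [F], of which
    only [k = 0] contributes. *)
Lemma norm_gamma F (b : A -> A -> C) : bicharacter b -> bichar_nondeg b ->
  u1_valued F -> (forall x y, F (x + y) = F x * F y * b x y) -> `|gamma F| = 1.
Proof.
move=> Hb ndg F1 FD; apply/eqP; rewrite -(@eqrXn2 _ 2) ?expr1n // normCK.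
rewrite /gamma rmorphM fmorphV /= sqrtC_nat_conj mulrACA -invfM -expr2 sqrtCK.
suff -> : (\sum_a F a) * (\sum_a F a)^* = #|A|%:R by rewrite mulVf ?card_neq0.
rewrite rmorph_sum mulr_sumr.
transitivity (\sum_k \sum_h F (k + h) * (F h)^*).
  rewrite exchange_big; apply: eq_bigr => h _ /=.
  by rewrite mulr_suml (reindex_inj (addIr h)).
under eq_bigr => k _ do rewrite (quadratic_correlation Hb) //.
by rewrite (bigD1 0) //= eqxx big1 ?addr0 // => k /negbTE->.
Qed.

Lemma quadratic_classP (q Q : A -> C) (eps : int) : metric_group q ->
  eps = 1 \/ eps = -1 -> quadratic_class q eps Q ->
  exists2 b : A -> A -> C, bicharacter b /\ bichar_nondeg b &
    u1_valued Q /\ forall x y, Q (x + y) = Q x * Q y * b x y.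
Proof.
move=> Hq Heps [chi Hchi QE].
have Hb := metric_bichar Hq; have q0 a : q a != 0 by apply/u1_neq0/metric_u1.
have qD a c : q (a + c) = q a * q c * pairing q a c.
  by rewrite /pairing mulrC divfK // mulf_neq0.
have Q1 : u1_valued Q.
  move=> a; rewrite QE normrM (char_u1 Hchi) mulr1.
  by case: Heps => ->; rewrite ?expr1z ?exprN1 ?normfV (metric_u1 Hq) ?invr1.
case: Heps QE => -> QE.
- exists (pairing q); first by split=> // x; apply: metric_nondeg.
  split=> // x y; rewrite !QE !expr1z qD (charD Hchi); ring.
exists (fun x y => (pairing q x y)^-1).
  split; first exact: bichar_inv.
  by move=> x bx1; apply: (metric_nondeg Hq) => y; rewrite -[LHS]invrK bx1 invr1.
by split=> // x y; rewrite !QE !exprN1 qD (charD Hchi) !invfM; ring.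
Qed.

Variable q : A -> C.
Hypothesis Hq : metric_group q.
Let Hb : bicharacter (pairing q) := metric_bichar Hq.
Let ndg : bichar_nondeg (pairing q) := metric_nondeg Hq.

Lemma opX_weyl a : opX C a = weyl (pairing q) a 0.
Proof. by apply/matrixP => i j; rewrite !mxE bichar0l. Qed.

Lemma opZ_weyl a : opZ q a = weyl (pairing q) 0 a.
Proof. by apply/matrixP => i j; rewrite !mxE addr0. Qed.

Lemma one_weyl : 1%:M = weyl (pairing q) 0 0.
Proof. by rewrite weyl0. Qed.

Lemma weylM_single0 (S : finZmodType) (b : S -> S -> C) n i j (s t s' t' : S) :
  bicharacter b -> t = 0 \/ s' = 0 ->
  weyl (@bichar_pow C S b n) (single n i s) (single n i t) *m
    weyl (@bichar_pow C S b n) (single n j s') (single n j t') =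
  weyl (@bichar_pow C S b n) (single n i s + single n j s')
    (single n i t + single n j t').
Proof.
move=> Hb' ts0; have Hp := bichar_powP Hb' n; rewrite (weylM Hp).
by case: ts0 => ->; rewrite single0 ?(bichar0l Hp) ?(bichar0r Hp) scale1r.
Qed.

Lemma pauliIE n i a : pauliI q n i a = pauli (pairing q) id (fun=> 0) (fun=> 0) id
  (fun=> 1) n i a.
Proof.
rewrite /pauliI opX_weyl opZ_weyl !site_weyl // weylM_single0 //; last by left.
by rewrite /pauli scale1r.
Qed.

Lemma enhanced_I (eps : int) (Q : A -> C) : eps = 1 \/ eps = -1 ->
  quadratic_class q eps Q ->
  forall T : tower (@nu_triv C A) (pairing q),
    enhanced_by_matrix_trace T (pauliI q) (fI Q)
      #|A|%:R (sqrtC #|A|%:R)^-1 1 (sqrtC #|A|%:R).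
Proof.
move=> Heps Qq T.
have [b [Hb' ndg'] [Q1 QD]] := quadratic_classP Hq Heps Qq.
have sA0 : sqrtC #|A|%:R != 0 :> C by rewrite sqrtC_eq0 card_neq0.
have sAV : (sqrtC #|A|%:R)^-1 * (sqrtC #|A|%:R)^-1 = #|A|%:R^-1 :> C.
  by rewrite -invfM -expr2 sqrtCK.
have f0 : fI Q 0 = (sqrtC #|A|%:R)^-1.
  by rewrite /fI (quadratic0 Hb' Q1 QD) mulr1.
rewrite -f0; apply: (enhanced_by_pauli Hb ndg (bichar_triv A) Hb
  _ _ _ _ _ _ _ _ T (P := pauliI q) (fun n i g _ => pauliIE n i g)) => //.
- by move=> g h; rewrite addr0.
- by move=> g h; rewrite addr0.
- by move=> g; rewrite normr1.
- by move=> g h; rewrite bichar0l // bichar0r // !mulr1.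
- by move=> g h; rewrite bichar0l // mulr1.
- move=> k; transitivity (#|A|%:R^-1 * \sum_h Q (k + h) * (Q h)^*).
    rewrite mulr_sumr; apply: eq_bigr => h _.
    rewrite /nu_triv /fI mulr1 rmorphM fmorphV /= sqrtC_nat_conj -sAV; ring.
  by rewrite (quadratic_correlation Hb') // mulrnAr mulVf ?card_neq0.
- exact: normr1.
- by rewrite f0 mul1r -{1}[#|A|%:R]sqrtCK expr2 mulfK.
- by rewrite f0 fmorphV /= sqrtC_nat_conj invr1 mul1r -{1}[#|A|%:R]sqrtCK expr2 mulfK.
Qed.

Lemma pauliIIE n i g : pauliII q n i g =
  pauli (pairing q) fst (fun g => - g.1) snd snd (fun=> 1) n i g.
Proof.
have Hp := bichar_powP Hb n.
rewrite /pauliII !opX_weyl !opZ_weyl !site_weyl // weylM_single0 //; last by left.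
rewrite (weylM Hp) !single0 !addr0 add0r (bichar0r Hp) scale1r.
by rewrite (weylM Hp) (bichar0r Hp) scale1r !addr0 /pauli scale1r.
Qed.

Lemma enhanced_II (E : {perm A}) (QE PE : A -> C) : admissible q E QE PE ->
  forall T : tower (@nu_triv C (A * A)%type) (tauII q),
    enhanced_by_matrix_trace T (pauliII q) (fII QE PE)
      #|A|%:R ((gamma PE)^* * #|A|%:R^-1) (gamma PE)^* 1.
Proof.
move=> [ED _ Q1 P1 QD PD] T; have A0 := card_neq0 A.
have EVD : {morph (E^-1)%g : x y / x + y}.
  by move=> x y; apply: (@perm_inj _ E); rewrite ED !permKV.
have HbE := bichar_twist Hb ED; have HbV := bichar_twist Hb EVD.
have ndgE := bichar_nondeg_twist ndg ED (@perm_inj _ E).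
have ndgV := bichar_nondeg_twist ndg EVD (@perm_inj _ (E^-1)%g).
have gam1 : `|gamma PE| = 1 := norm_gamma HbV ndgV P1 PD.
have f0 : fII QE PE 0 = (gamma PE)^* * #|A|%:R^-1.
  by rewrite /fII (quadratic0 HbE Q1 QD) (quadratic0 HbV P1 PD) !mulr1.
rewrite -f0; apply: (enhanced_by_pauli Hb ndg (bichar_triv _) (bichar_tauII Hq)
  _ _ _ _ _ _ _ _ T (P := pauliII q) (fun n i g _ => pauliIIE n i g)) => //.
- by move=> g h; rewrite opprD.
- by move=> [t c] /= -> ->.
- by move=> g; rewrite normr1.
- by move=> g h; rewrite bicharNr // divff ?bichar_neq0 // !mulr1.
- move=> g h; rewrite /tauII bicharNr // mulfK ?bichar_neq0 //.
- move=> k; pose F (g : A * A) := QE g.1 * PE g.2.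
  have F1 : u1_valued F by move=> g; rewrite normrM Q1 P1 mulr1.
  have FD g h : F (g + h) = F g * F h * bichar_prod
      (fun x y => pairing q (E x) y) (fun x y => pairing q ((E^-1)%g x) y) g h.
    by rewrite /F QD PD /bichar_prod; ring.
  have Hprod := bichar_prodP HbE HbV.
  have := quadratic_correlation Hprod k (bichar_nondeg_prod HbE HbV ndgE ndgV) F1 FD.
  move=> Fcorr.
  (* The phase gamma(P_E) cancels against its conjugate, leaving the correlation of the quadratic
     function [F] on A + A. *)
  transitivity (#|A|%:R^-1 ^+ 2 * \sum_h F (k + h) * (F h)^*).
    rewrite mulr_sumr; apply: eq_bigr => h _.
    rewrite /nu_triv /fII /F; move: (gamma PE) gam1 => c c1.
    rewrite mulr1 !rmorphM /= conjCK fmorphV /= conjC_nat (conjC_u1 c1); field.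
    by rewrite A0 u1_neq0.
  rewrite Fcorr card_prod natrM.
  by case: (k == 0); rewrite ?mulr0 // !mulr1n; field.
- by rewrite norm_conjC.
- exact: oner_neq0.
- by rewrite f0 mulr1 mulrCA mulfV // mulr1.
- rewrite f0; move: (gamma PE) gam1 => c c1.
  rewrite rmorphM /= conjCK fmorphV /= conjC_nat mulrCA mulfV // (conjC_u1 c1).
  by rewrite invrK.
Qed.

Let bW : A * A -> A * A -> C := bichar_prod (pairing q) (pairing q).

(** The extra phase [pairing q g.1 (- g.2)] comes from moving the shifts to the left of the diagonal
    operators; they interact only in the first factor of the right site. *)
Lemma pauliIIIE n i g : (0 < i < n)%N -> pauliIII q n i g =
  pauli bW (fun g => (- g.2, 0)) (fun g => (- g.2, - g.2))
    (fun g => (0, g.1)) (fun g => (g.1, 0))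
    (fun g => (q g.1)^-1 * (q g.2)^-1 * pairing q g.1 (- g.2)) n i g.
Proof.
move=> lt_in; case: g => [a c] /=.
have HbW : bicharacter bW by apply: bichar_prodP.
have Hp := bichar_powP HbW n.
rewrite /pauliIII /opP /opQ !opX_weyl !opZ_weyl one_weyl !tens_weyl !site_weyl //.
rewrite -!/bW weylM_single0 //; last by right.
rewrite weylM_single0 //; last by left.
rewrite -!/(two_site n i _ _) (weylM Hp) !two_site0 addr0 add0r.
rewrite bichar_two_site // eqxx ltn_eqF // gtn_eqF // !mulr1 /bW /bichar_prod /=.
by rewrite !bichar0l // bichar0r // !mul1r mulr1 scalerA.
Qed.

Lemma enhanced_III (T : tower (nuIII q) (tauIII q)) :
  enhanced_by_matrix_trace T (pauliIII q) (@fIII C A)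
    (#|A|%:R ^+ 2) #|A|%:R^-1 1 #|A|%:R.
Proof.
have A0 := card_neq0 A; have HbW : bicharacter bW by apply: bichar_prodP.
have q0 a : q a != 0 by apply/u1_neq0/metric_u1.
have qD a c : q (a + c) = q a * q c * pairing q a c.
  by rewrite /pairing mulrC divfK // mulf_neq0.
have Hnu := bichar_nuIII Hq.
rewrite -[#|A|%:R^-1]/(fIII C (0 : A * A)).
apply: (enhanced_by_pauli HbW _ Hnu (bichar_tauIII Hq)
  _ _ _ _ _ _ _ _ T (P := pauliIII q) pauliIIIE) => //.
- exact: bichar_nondeg_prod.
- by move=> g h /=; rewrite -[RHS]/(_, _) addr0 opprD.
- by move=> g h /=; rewrite -[RHS]/(_, _) !opprD.
- by move=> g h /=; rewrite -[RHS]/(_, _) addr0.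
- by move=> g h /=; rewrite -[RHS]/(_, _) addr0.
- by move=> [a c] [/eqP]; rewrite oppr_eq0 => /eqP-> [->].
- move=> g; rewrite normrM (bichar_u1 Hb) mulr1 normrM !normfV !(metric_u1 Hq).
  by rewrite invr1 mulr1.
- move=> [a c] [a' c']; rewrite /bW /bichar_prod /nuIII /=.
  rewrite !qD !(bicharDl Hb) !(bicharNr Hb) !(bicharDr Hb).
  rewrite !(bichar0l Hb) !(bichar0r Hb) (metric_sym Hq a' c).
  by field; rewrite !q0 !(bichar_neq0 Hb).
- move=> [a c] [a' c']; rewrite /bW /bichar_prod /tauIII /=.
  rewrite !(bicharNr Hb) !(bichar0l Hb) (metric_sym Hq a' c).
  by field; rewrite !(bichar_neq0 Hb).
- by rewrite card_prod natrM.
(* With [f] constant, the correlation is a character sum of [nuIII] itself. *)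
- move=> k; rewrite /fIII -mulr_sumr (reindex_inj oppr_inj) /=.
  under eq_bigr => h _ do rewrite opprK.
  rewrite bichar_sum // => [|[a c] nu1].
    rewrite card_prod natrM fmorphV /= conjC_nat.
    by case: (k == 0); rewrite ?mulr0 // !mulr1n; field.
  (* Nondegeneracy of [nuIII] is triangular: testing on (0, y) isolates [c], then testing on (y, 0)
     isolates [a]. *)
  have c0 : c = 0.
    apply: ndg => y; have := nu1 (0, y); rewrite /nuIII /=.
    by rewrite !(bichar0r Hb) !mul1r.
  congr pair => //; apply: ndg => y; have := nu1 (y, 0); rewrite /nuIII c0 /=.
  by rewrite !(bichar0l Hb) !mulr1.
- by rewrite normr1.
- by rewrite /fIII mul1r expr2 mulfK.
- by rewrite /fIII fmorphV /= conjC_nat invr1 mul1r expr2 mulfK.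
Qed.

End Families.

Theorem theorem7p3 (R : realType) (A : finZmodType) (q : A -> R[i])
    (Hq : metric_group q) :
  [/\ (* Family I *)
      forall (eps : int) (Q : A -> R[i]), eps = 1 \/ eps = -1 ->
        quadratic_class q eps Q ->
      forall T : tower (@nu_triv R[i] A) (pairing q),
        enhanced_by_matrix_trace T (pauliI q) (fI Q)
          #|A|%:R (sqrtC #|A|%:R)^-1 1 (sqrtC #|A|%:R),
      (* Family II *)
      forall (E : {perm A}) (QE PE : A -> R[i]), admissible q E QE PE ->
      forall T : tower (@nu_triv R[i] (A * A)%type) (tauII q),
        enhanced_by_matrix_trace T (pauliII q) (fII QE PE)
          #|A|%:R ((gamma PE)^* * #|A|%:R^-1) (gamma PE)^* 1
    & (* Family III *)
      forall T : tower (nuIII q) (tauIII q),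
        enhanced_by_matrix_trace T (pauliIII q) (@fIII R[i] A)
          (#|A|%:R ^+ 2) #|A|%:R^-1 1 #|A|%:R].
Proof.
split; [exact: enhanced_I | exact: enhanced_II | exact: enhanced_III].
Qed.
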